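(* Let $\mathbb{F}$ be a field of characteristic not $2$ and let $L$ be a nilpotent symplectic alternating algebra over $\mathbb{F}$ of dimension $10$ that has an isotropic centre of dimension $3$. Suppose also that $L$ has the further properties that $\dim L^{3}=6$, $L^{3}L^{2}=L^{5}$ and $L$ is of type C. Then $L$ has a presentation of the form $$\mathcal{P}_{10}^{(3,8)}(r,s):\ (x_{2}y_{4},y_{5})=r,\ (x_{1}y_{3},y_{5})=s,\ (x_{1}y_{2},y_{4})=1,\ (y_{1}y_{2},y_{5})=1,\ (y_{1}y_{3},y_{4})=1,$$ where $r,s\in\mathbb{F}$, $r\neq 0$ and $s\notin\mathbb{F}^{2}$. Furthermore, for $r,\tilde r\in\mathbb{F}\setminus\{0\}$ and $s,\tilde s\in\mathbb{F}\setminus\mathbb{F}^2$, the presentations $\mathcal{P}_{10}^{(3,8)}(\tilde r,\tilde s)$ and $\mathcal{P}_{10}^{(3,8)}(r,s)$ describe the same algebra (up to isomorphism) if and only if $$\frac{\tilde r}{r}\in(\mathbb{F}^{*})^{3}\quad\text{and}\quad \frac{s}{\tilde s}\in G(s),$$ where $G(s)=\{(x^{2}-y^{2}s)^{2}:\ (x,y)\in\mathbb{F}\times\mathbb{F}\setminus\{(0,0)\}\}$.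
   Context: A symplectic alternating algebra (SAA) over a field $\mathbb{F}$ is a finite-dimensional $\mathbb{F}$-vector space $L$ with a non-degenerate alternating bilinear form $(\ ,\ )$ and a bilinear alternating product $L\times L\to L$, $(x,y)\mapsto xy$ (so $xx=0$), such that $(xy,z)=(yz,x)$ for all $x,y,z\in L$. It follows that $(x,y,z)\mapsto (xy,z)$ is an alternating trilinear form. Isomorphisms of SAAs are linear bijections preserving the form and the product. For subspaces $A,B$, $AB$ denotes the linear span of all products $ab$ with $a\in A,b\in B$. The lower central series is $L^1=L$, $L^{k+1}=L^k L$; the upper central series is $Z_0(L)=0$, $Z_{k+1}(L)=\{x\in L: xL\leq Z_k(L)\}$, with $Z(L)=Z_1(L)$ the centre. $L$ is nilpotent if $L^{k}=0$ for some $k$. A subspace is isotropic if the form vanishes identically on it. A standard basis of a $10$-dimensional SAA is a basis $x_1,y_1,\ldots,x_5,y_5$ with $(x_i,x_j)=(y_i,y_j)=0$ and $(x_i,y_j)=\delta_{ij}$ for all $i,j$. A presentation lists values of triples $(uv,w)$ with $u,v,w$ distinct elements of a standard basis; the convention is that all triple values of basis elements not listed (and not determined from the listed ones by the alternating property) are $0$. Such data determine the product, hence the SAA, uniquely. $\mathbb{F}^{*}=\mathbb{F}\setminus\{0\}$, $\mathbb{F}^2=\{b^2:b\in\mathbb{F}\}$ is the set of squares in $\mathbb{F}$, and $(\mathbb{F}^{*})^{3}=\{b^3: b\in\mathbb{F}^{*}\}$. Types. Let $L$ be a nilpotent SAA of dimension $10$ with isotropic centre of dimension $3$, $\dim L^3=6$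 and $L^3L^2=L^5$. Then one can choose a standard basis adapted to the central series in the sense that $L^{5}=\mathbb{F}x_{5}+\mathbb{F}x_{4}$, $Z(L)=L^5+\mathbb{F}x_{3}$, $Z_{2}(L)=L^{4}=Z(L)+\mathbb{F}x_{2}$, $Z_{3}(L)=L^{3}=L^4+\mathbb{F}x_{1}+\mathbb{F}y_{1}$, $L^{2}=L^{3}+\mathbb{F}y_{2}$, $Z_{4}(L)=L^{3}+\mathbb{F}y_{2}+\mathbb{F}y_{3}$. Since $L^4Z_4(L)=0$, the linear maps $\phi,\psi: L^{3}/L^{4}\to L^{5}$, $\phi(u+L^4)=uy_2$, $\psi(u+L^4)=uy_3$, are well defined; $\phi$ is bijective because $L^3L^2=L^5$. Put $\tau=\psi\phi^{-1}:L^5\to L^5$. The minimal polynomial of $\tau$ has degree $2$, and exactly one of the following holds, independently of the choice of adapted standard basis: type A: the minimal polynomial of $\tau$ has two distinct roots in $\mathbb{F}$; type B: it has a double root in $\mathbb{F}$; type C: it is irreducible in $\mathbb{F}[t]$. *)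

(* Defs.v *)
From HB Require Import structures.
From mathcomp Require Import all_boot all_order all_algebra.
From mathcomp Require Import sesquilinear.
From mathcomp Require Import ring.

Set Implicit Arguments.
Unset Strict Implicit.
Unset Printing Implicit Defensive.

Import GRing.Theory.
Local Open Scope ring_scope.

Record saa (F : fieldType) := SAA {
  saa_sort :> vectType F;
  sform : {biscalar saa_sort};
  smul : {bilinear saa_sort -> saa_sort -> saa_sort};
  sform_alt : forall u, sform u u = 0;
  sform_nondeg : forall u, (forall v, sform u v = 0) -> u = 0;
  smul_alt : forall u, smul u u = 0;
  sform_smul : forall u v w, sform (smul u v) w = sform (smul v w) u
}.

Arguments sform {F s}.
Arguments smul {F s}.

Definition saa_iso (F : fieldType) (L M : saa F) : Prop :=
  exists f : {linear L -> M},
    [/\ bijective f,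
        forall u v, sform (f u) (f v) = sform u v
      & forall u v, f (smul u v) = smul (f u) (f v)].

Section Series.
Variables (F : fieldType) (L : saa F).

Definition rmul (v : L) : 'End(L) := linfun (applyr (@smul F L) v).

(* By bilinearity this is the span of all products: see memv_sprod, sprod_subP *)
Definition sprod (A B : {vspace L}) : {vspace L} :=
  <<allpairs (@smul F L) (vbasis A) (vbasis B)>>%VS.

(* L^k for k > 0, with L^1 = L; the value at k = 0 is junk *)
Definition lcs (k : nat) : {vspace L} :=
  iter k.-1 (fun A => sprod A fullv) fullv.

Fixpoint ucs (k : nat) : {vspace L} :=
  if k is k'.+1 then (\bigcap_(v <- vbasis {:L}) (rmul v @^-1: ucs k'))%VS
  else 0%VS.

Definition centre : {vspace L} := ucs 1.

Definition nilpotent : Prop := exists k : nat, (0 < k)%N /\ lcs k = 0%VS.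

Definition isotropic (A : {vspace L}) : Prop :=
  forall u v, u \in A -> v \in A -> sform u v = 0.

Lemma rmulE u v : rmul v u = smul u v.
Proof. by rewrite lfunE. Qed.

Lemma memv_sprod (A B : {vspace L}) u v :
  u \in A -> v \in B -> smul u v \in sprod A B.
Proof.
move=> /coord_vbasis -> /coord_vbasis ->.
rewrite linear_sumlz; apply: memv_suml => i _ /=.
rewrite linear_sumr; apply: memv_suml => j _ /=.
rewrite linearZlr /= memvZ // memvZ //.
by apply/memv_span/allpairsP; exists ((vbasis A)`_i, (vbasis B)`_j);
  rewrite /= !mem_nth ?size_tuple.
Qed.

Lemma sprod_subP (A B C : {vspace L}) :
  reflect (forall u v, u \in A -> v \in B -> smul u v \in C)
          (sprod A B <= C)%VS.
Proof.
apply: (iffP idP) => [/subvP sABC u v uA vB | sABC].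
  exact/sABC/memv_sprod.
apply/span_subvP=> _ /allpairsP[[u v] /= [uA vB ->]].
by apply: sABC; apply: vbasis_mem.
Qed.

Lemma memv_ucsS k u :
  reflect (forall v, smul u v \in ucs k) (u \in ucs k.+1).
Proof.
have memE (s : seq L) : u \in (\bigcap_(v <- s) (rmul v @^-1: ucs k))%VS =
    all (fun v => smul u v \in ucs k) s.
  elim: s => [|v s IHs] /=; first by rewrite big_nil memvf.
  by rewrite big_cons memv_cap -memv_preim IHs rmulE.
rewrite [ucs k.+1]/= memE.
apply: (iffP allP) => [uZ v | uZ v _]; last exact: uZ.
rewrite (coord_vbasis (memvf v)) linear_sumr; apply: memv_suml => i _.
by rewrite linearZr_LR /= memvZ // uZ // mem_nth ?size_tuple.
Qed.

End Series.

(* The index k = 1, ..., 5 of the mathematical text, as an element of 'I_5 *)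
Definition idx (k : nat) : 'I_5 := inZp k.-1.

(* inl i stands for x_i and inr i for y_i *)
Definition bindex : finType := ('I_5 + 'I_5)%type.

Definition bvec (V : Type) (x y : 'I_5 -> V) (u : bindex) : V :=
  match u with inl i => x i | inr i => y i end.

Definition standard_basis (F : fieldType) (L : saa F) (x y : 'I_5 -> L) : Prop :=
  [/\ basis_of {:L} (codom x ++ codom y),
      forall i j, sform (x i) (x j) = 0,
      forall i j, sform (y i) (y j) = 0
    & forall i j, sform (x i) (y j) = (i == j)%:R].

(* The entry (u, v, w, t) stands for the listed triple value (uv, w) = t *)
Definition presentation (F : fieldType) := seq (bindex * bindex * bindex * F).

Definition presents (F : fieldType) (p : presentation F) (L : saa F)
    (x y : 'I_5 -> L) : Prop :=
  let triple u v w :=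
    sform (smul (bvec x y u) (bvec x y v)) (bvec x y w) in
  (forall u v w t, (u, v, w, t) \in p -> triple u v w = t) /\
  (forall u v w, uniq [:: u; v; w] ->
     (forall a b c t, (a, b, c, t) \in p ->
        ~~ perm_eq [:: a; b; c] [:: u; v; w]) ->
     triple u v w = 0).

Definition has_presentation (F : fieldType) (L : saa F) (p : presentation F) :
    Prop :=
  exists x y : 'I_5 -> L, standard_basis x y /\ presents p x y.

Definition ix (k : nat) : bindex := inl (idx k).
Definition iy (k : nat) : bindex := inr (idx k).

Definition P_10_3_8 (F : fieldType) (r s : F) : presentation F :=
  [:: (ix 2, iy 4, iy 5, r); (ix 1, iy 3, iy 5, s); (ix 1, iy 2, iy 4, 1);
      (iy 1, iy 2, iy 5, 1); (iy 1, iy 3, iy 4, 1)].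

Section TypeC.
Variables (F : fieldType) (L : saa F).

Definition adapted (x y : 'I_5 -> L) : Prop :=
  [/\ standard_basis x y,
      lcs L 5 = (<[x (idx 5)]> + <[x (idx 4)]>)%VS,
      centre L = (lcs L 5 + <[x (idx 3)]>)%VS,
      ucs L 2 = lcs L 4 /\ lcs L 4 = (centre L + <[x (idx 2)]>)%VS
    & [/\ ucs L 3 = lcs L 3,
          lcs L 3 = (lcs L 4 + <[x (idx 1)]> + <[y (idx 1)]>)%VS,
          lcs L 2 = (lcs L 3 + <[y (idx 2)]>)%VS
        & ucs L 4 = (lcs L 3 + <[y (idx 2)]> + <[y (idx 3)]>)%VS]].

(* u |-> uv on L^3; for v in Z_4(L) it vanishes on L^4 *)
Definition mul3 (v : L) : 'Hom(subvs_of (lcs L 3), L) :=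
  (rmul v \o linfun vsval)%VF.

(* tau = psi phi^-1, with phi and psi read on L^3 instead of L^3/L^4.  Here
   (mul3 v2)^-1 is a linear section of mul3 v2 over its image L^5; as psi
   vanishes on L^4, the kernel of mul3 v2, the choice of the section is
   irrelevant.  Only the values of tau on L^5 are meaningful. *)
Definition tau (v2 v3 : L) : 'End(L) := (mul3 v3 \o (mul3 v2)^-1)%VF.

(* The matrix of tau : L^5 -> L^5 in the basis x_5, x_4 *)
Definition tau_mx (x y : 'I_5 -> L) : 'M[F]_2 :=
  let b := [tuple x (idx 5); x (idx 4)] in
  \matrix_(i, j) coord b j (tau (y (idx 2)) (y (idx 3)) b`_i).

(* The type does not depend on the adapted basis; the degree of the minimal
   polynomial is always 2 for an adapted basis. *)
Definition type_C : Prop :=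
  exists x y : 'I_5 -> L,
    adapted x y /\ irreducible_poly (mxminpoly (tau_mx x y)).

End TypeC.

Definition is_square (F : fieldType) (a : F) : Prop := exists b, a = b ^+ 2.

Definition is_nonzero_cube (F : fieldType) (a : F) : Prop :=
  exists b, b != 0 /\ a = b ^+ 3.

Definition in_G (F : fieldType) (s a : F) : Prop :=
  exists x y : F, (x, y) != (0, 0) /\ a = (x ^+ 2 - y ^+ 2 * s) ^+ 2.

(* Every P_10_3_8 r s is the presentation of some algebra. *)

Section Model.
Variables (F : fieldType) (r s : F).

Let V := {ffun bindex -> F^o}.
Implicit Types (f g h : V).

Let form f g : F :=
  \sum_(i < 5) (f (inl i) * g (inr i) - f (inr i) * g (inl i) : F).

Let det3 (a b c : bindex) f g h : F :=
  (f a : F) * (g b * h c - g c * h b) - (f b : F) * (g a * h c - g c * h a)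
  + (f c : F) * (g a * h b - g b * h a).

Let T f g h : F :=
  r * det3 (ix 2) (iy 4) (iy 5) f g h + s * det3 (ix 1) (iy 3) (iy 5) f g h
  + det3 (ix 1) (iy 2) (iy 4) f g h + det3 (iy 1) (iy 2) (iy 5) f g h
  + det3 (iy 1) (iy 3) (iy 4) f g h.

Let e (u : bindex) : V := [ffun w => (w == u)%:R].

Let mul f g : V :=
  [ffun u => match u with inl i => T f g (e (inr i))
                        | inr i => - T f g (e (inl i)) end].

Let formP : bilinear_for *%R *%R form.
Proof.
split=> f a g h.
  rewrite [RHS](_ : _ = a * form g f + form h f) // /form mulr_sumr -big_split.
  by apply: eq_bigr => i _; rewrite /= !ffunE /GRing.scale /=; ring.
rewrite [RHS](_ : _ = a * form f g + form f h) // /form mulr_sumr -big_split.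
by apply: eq_bigr => i _; rewrite /= !ffunE /GRing.scale /=; ring.
Qed.

Let mulP : bilinear_for *:%R *:%R mul.
Proof.
split=> f a g h; apply/ffunP=> -[] i; rewrite !ffunE /T /det3 !ffunE;
  rewrite /GRing.scale /=; ring.
Qed.

Let formB : {biscalar V} :=
  HB.pack form (bilinear_isBilinear.Build F V V F *%R *%R form formP).
Let mulB : {bilinear V -> V -> V} :=
  HB.pack mul (bilinear_isBilinear.Build F V V V *:%R *:%R mul mulP).

Let form_alt f : form f f = 0.
Proof. by rewrite /form big1 // => i _; rewrite mulrC subrr. Qed.

Let form_e f u : form f (e u) =
  match u with inl i => - f (inr i) | inr i => f (inl i) end.
Proof.
case: u => i; rewrite /form (bigD1 i) //= big1 ?addr0 => [|j /negPf ji];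
  rewrite !ffunE /eq_op /= ?eqxx ?ji ?mulr1 ?mulr0 ?subr0 ?sub0r ?oppr0 //.
Qed.

Let form_nondeg f : (forall g, form f g = 0) -> f = 0.
Proof.
move=> f0; apply/ffunP=> -[] i; rewrite ffunE.
  by have := f0 (e (inr i)); rewrite form_e.
by have /eqP := f0 (e (inl i)); rewrite form_e oppr_eq0 => /eqP.
Qed.

Let mul_alt f : mul f f = 0.
Proof. by apply/ffunP=> -[] i; rewrite !ffunE /T /det3; ring. Qed.

Let T_lin f g : linear_for *%R (T f g).
Proof. by move=> a h k; rewrite /T /det3 !ffunE /GRing.scale /=; ring. Qed.

Let sum_e f : f = \sum_u f u *: e u.
Proof.
apply/ffunP=> u; rewrite sum_ffunE (bigD1 u) //= big1 => [|v /negPf vu];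
  rewrite !ffunE ?eqxx ?(eq_sym u) ?vu /GRing.scale /= ?mulr0 //.
by rewrite mulr1 addr0.
Qed.

Let TL f g : {linear V -> F | *%R} :=
  HB.pack (T f g) (GRing.isLinear.Build F V F *%R (T f g) (T_lin f g)).

Let form_mulE f g h : form (mul f g) h = T f g h.
Proof.
rewrite -[RHS]/(TL f g h) [in RHS](sum_e h) linear_sum big_sumType.
transitivity (\sum_(i < 5) h (inl i) * T f g (e (inl i))
              + \sum_(i < 5) h (inr i) * T f g (e (inr i)) : F); last first.
  by congr (_ + _); apply: eq_bigr => i _; rewrite linearZ.
by rewrite -big_split; apply: eq_bigr => i _; rewrite /= !ffunE; ring.
Qed.

Let form_mul f g h : form (mul f g) h = form (mul g h) f.
Proof. by rewrite !form_mulE /T /det3; ring. Qed.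

Definition P_10_3_8_saa : saa F :=
  @SAA F V formB mulB form_alt form_nondeg mul_alt form_mul.

Let det3_e0 a b c u v w :
  ~~ perm_eq [:: a; b; c] [:: u; v; w] -> det3 a b c (e u) (e v) (e w) = 0.
Proof.
move=> nperm.
have e0 (k1 k2 k3 : bindex) : perm_eq [:: k1; k2; k3] [:: a; b; c] ->
    (k1 == u)%:R * ((k2 == v)%:R * (k3 == w)%:R) = 0 :> F.
  move=> kabc; do 3![case: eqP => [?|_]; last by rewrite !(mulr0, mul0r)].
  by subst; rewrite perm_sym kabc in nperm.
rewrite /det3 !ffunE. rewrite !mulrBr !e0 ?subrr ?addr0 //;
  by apply/permP=> P /=; ring.
Qed.

Lemma P_10_3_8_saaP : has_presentation P_10_3_8_saa (P_10_3_8 r s).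
Proof.
pose x i : P_10_3_8_saa := e (inl i); pose y i : P_10_3_8_saa := e (inr i).
have bE u : bvec x y u = e u by case: u.
have dimV : \dim {:P_10_3_8_saa} = 10.
  rewrite dimvf [LHS](_ : _ = (#|{: 'I_5 + 'I_5}| * 1)%N) //.
  by rewrite card_sum !card_ord.
exists x, y; split; first split.
- rewrite basisEdim size_cat !size_codom !card_ord dimV.
  rewrite andbT; apply/subvP=> f _; rewrite (sum_e f).
  apply: memv_suml => u _; apply/memvZ/memv_span.
  by rewrite mem_cat; case: u => i; [rewrite (codom_f x i)
    | rewrite (codom_f y i) orbT].
- by move=> i j; rewrite [LHS](form_e (e (inl i)) (inl j)) ffunE /= oppr0.
- by move=> i j; rewrite [LHS](form_e (e (inr i)) (inr j)) ffunE.
- by move=> i j; rewrite [LHS](form_e (e (inl i)) (inr j)) ffunE eq_sym.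
split=> [u v w t | u v w uvw nlisted]; rewrite !bE [LHS]form_mulE.
  rewrite !inE => H.
  repeat (case/orP: H => H); case/eqP: H => -> -> -> ->;
    rewrite /T /det3 !ffunE;
    repeat match goal with |- context [@eq_op ?A ?a ?b] =>
      let c := eval vm_compute in (@eq_op A a b) in
      change (@eq_op A a b) with c end; rewrite /=; ring.
rewrite /T.
rewrite !det3_e0 ?mulr0 ?addr0 //;
  [ apply: (nlisted _ _ _ 1) | apply: (nlisted _ _ _ 1)
  | apply: (nlisted _ _ _ 1) | apply: (nlisted _ _ _ s)
  | apply: (nlisted _ _ _ r)];
  by rewrite !inE eqxx ?orbT.
Qed.

End Model.

(* Main.v *)
Require Import Defs.
From HB Require Import structures.
From mathcomp Require Import all_boot all_order all_algebra.
From mathcomp Require Import ring.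

(** An algebra is determined by its trilinear form (uv, w), which is alternating,
    so on a symplectic space of dimension 10 it is a trivector, and a presentation
    lists its coefficients in a standard basis.  With this point of view
    ([presentsP]) a change of presentation is a symplectic change of basis that
    transforms one trivector into another, which is checked as one polynomial
    identity in the coordinates.

    Existence.  The central series of an adapted basis forces all but fifteen
    coefficients to vanish ([presents_adapted]).  These contain the matrices of
    phi and psi on the plane L^3/L^4, and tau = psi phi^-1.  Type C means that tau
    has no eigenvalue in F: for an eigenvalue, the irreducible minimal polynomial
    would be linear and tau a scalar l, and then y3 - l y2 would already lie in
    Z_3(L) = L^3 ([adapted_pencil]).  Choosing x4 and x5 as products by y2 makes
    phi the identity ([normalize_phi]).  Six coefficients are then removed by
    adding vectors from lower terms of the series ([kill_tail]).  As 2 <> 0, a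
    multiple of y2 can be subtracted from y3 to make tau traceless; then tau^2 is
    a scalar, and a basis of the plane in which tau maps x5 to x4 gives the normal
    form, where tau^2 = s is not a square ([normalize_psi]).

    Classification.  Two algebras with the same presentation are isomorphic and an
    isomorphism transports presentations, so the question is when one algebra has
    both P(r, s) and P(r', s').  The plane L^3/L^4 is a line over the quadratic
    extension F[t] with t^2 = s.  Multiplying y1 by a + b t and y2 by c changes s
    to s / (a^2 - b^2 s)^2 and r to r / c^3 ([P_10_3_8_rescale]).  Conversely two
    presenting bases respect the same characteristic subspaces, and modulo these
    they differ exactly by such a change; that y3 goes to a multiple of itself
    modulo L^3 follows from the trace of tau, again using 2 <> 0
    ([presentation_parameters]). *)

Set Implicit Arguments.
Unset Strict Implicit.
Unset Printing Implicit Defensive.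

Import GRing.Theory.
Local Open Scope ring_scope.

(** * The alternating trilinear form *)

Section Bilinearity.
Variables (F : fieldType) (L : saa F).
Implicit Types (u v w : L) (k : F).

Lemma sformDl u v w : sform (u + v) w = sform u w + sform v w.
Proof. exact: linearDl. Qed.

Lemma sformDr u v w : sform u (v + w) = sform u v + sform u w.
Proof. exact: linearDr. Qed.

Lemma sformZl k u w : sform (k *: u) w = k * sform u w.
Proof. exact: linearZl_LR. Qed.

Lemma sformZr k u w : sform u (k *: w) = k * sform u w.
Proof. exact: linearZr_LR. Qed.

Lemma sformNl u w : sform (- u) w = - sform u w.
Proof. by rewrite -scaleN1r sformZl mulN1r. Qed.

Lemma sformNr u w : sform u (- w) = - sform u w.
Proof. by rewrite -scaleN1r sformZr mulN1r. Qed.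

Lemma sform0l w : sform 0 w = 0.
Proof. by rewrite -(scale0r 0) sformZl mul0r. Qed.

Lemma sform0r w : sform w 0 = 0.
Proof. by rewrite -(scale0r 0) sformZr mul0r. Qed.

Lemma smulDl u v w : smul (u + v) w = smul u w + smul v w.
Proof. exact: linearDl. Qed.

Lemma smulDr u v w : smul u (v + w) = smul u v + smul u w.
Proof. exact: linearDr. Qed.

Lemma smulZl k u w : smul (k *: u) w = k *: smul u w.
Proof. exact: linearZl_LR. Qed.

Lemma smulZr k u w : smul u (k *: w) = k *: smul u w.
Proof. exact: linearZr_LR. Qed.

End Bilinearity.

Definition sformE := (sformDl, sformDr, sformZl, sformZr, sformNl, sformNr).

Section Triple.
Variables (F : fieldType) (L : saa F).
Implicit Types (u v w : L) (k : F).

Lemma sformC u v : sform u v = - sform v u.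
Proof.
have /eqP := sform_alt (u + v).
by rewrite !sformE !sform_alt addr0 add0r addr_eq0 => /eqP.
Qed.

Definition triple u v w : F := sform (smul u v) w.

Lemma triple_rot u v w : triple u v w = triple v w u.
Proof. exact: sform_smul. Qed.

Lemma tripleZD k u1 u2 v w :
  triple (k *: u1 + u2) v w = k * triple u1 v w + triple u2 v w.
Proof. by rewrite /triple smulDl smulZl sformDl sformZl. Qed.

Lemma triplevv u w : triple u u w = 0.
Proof. by rewrite /triple smul_alt sform0l. Qed.

Lemma tripleC u v w : triple u v w = - triple v u w.
Proof.
have := triplevv (u + v) w; rewrite /triple !(smulDl, smulDr) !sformDl.
rewrite -!/(triple _ _ _) !triplevv add0r addr0 => /eqP.
by rewrite addr_eq0 => /eqP.
Qed.

Lemma tripleCr u v w : triple u v w = - triple u w v.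
Proof. by rewrite triple_rot tripleC triple_rot triple_rot. Qed.

Lemma smul_eq0 u : (forall v w, triple u v w = 0) -> forall v, smul u v = 0.
Proof. by move=> T0 v; apply: sform_nondeg => w; apply: T0. Qed.

End Triple.

(** * Coordinates in a standard basis *)

Section Coordinates.
Variables (F : fieldType) (L : saa F) (x y : 'I_5 -> L).
Implicit Types (u v w : L) (a b c : bindex) (k : F).

Definition coordinate a v : F :=
  match a with inl i => sform v (y i) | inr i => sform (x i) v end.

Lemma coordinateZD a k u v :
  coordinate a (k *: u + v) = k * coordinate a u + coordinate a v.
Proof. by case: a => i /=; rewrite !sformE. Qed.

Lemma coordinate_lincomb a (I : finType) (k : I -> F) (f : I -> L) :
  coordinate a (\sum_i k i *: f i) = \sum_i k i * coordinate a (f i).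
Proof.
by case: a => j /=; rewrite ?linear_sumlz ?linear_sumr; apply: eq_bigr => i _;
  rewrite /= sformE.
Qed.

(** The value at (u, v, w) of the wedge product of the linear forms f, g, h. *)
Definition det3 (f g h : L -> F) u v w : F :=
  f u * (g v * h w - g w * h v) - f v * (g u * h w - g w * h u)
  + f w * (g u * h v - g v * h u).

(** The alternating trilinear form that a presentation describes: each listed
    value contributes a multiple of the wedge product of three coordinate
    forms. *)
Definition trivector (p : presentation F) u v w : F :=
  \sum_(q <- p) q.2 *
     det3 (coordinate q.1.1.1) (coordinate q.1.1.2) (coordinate q.1.2) u v w.

Hypothesis xyB : standard_basis x y.

Lemma sform_xx i j : sform (x i) (x j) = 0. Proof. by case: xyB. Qed.
Lemma sform_yy i j : sform (y i) (y j) = 0. Proof. by case: xyB. Qed.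
Lemma sform_xy i j : sform (x i) (y j) = (i == j)%:R. Proof. by case: xyB. Qed.
Lemma sform_yx i j : sform (y i) (x j) = - (i == j)%:R.
Proof. by rewrite sformC sform_xy eq_sym. Qed.

Lemma coordinate_bvec a b : coordinate a (bvec x y b) = (a == b)%:R.
Proof.
case: a b => i [j|j] /=; rewrite ?sform_xx ?sform_yy ?sform_xy //.
by rewrite eq_sym.
Qed.

Lemma coordinate_sum v : v = \sum_a coordinate a v *: bvec x y a.
Proof.
pose P u := u = \sum_a coordinate a u *: bvec x y a; rewrite -/(P v).
have PZD k u w : P u -> P w -> P (k *: u + w).
  move=> Pu Pw; rewrite /P [in LHS]Pu [in LHS]Pw scaler_sumr -big_split.
  by apply: eq_bigr => a _; rewrite coordinateZD scalerDl scalerA.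
have Pbvec a : P (bvec x y a).
  rewrite /P (bigD1 a) //= coordinate_bvec eqxx scale1r big1 ?addr0 // => b ba.
  by rewrite coordinate_bvec (negPf ba) scale0r.
have P0 : P 0.
  rewrite -(addNr (x 0)) -scaleN1r.
  exact: (PZD _ _ _ (Pbvec (inl 0)) (Pbvec (inl 0))).
have PX u : u \in codom x ++ codom y -> P u.
  rewrite mem_cat => /orP[] /codomP[j ->]; first exact: (Pbvec (inl j)).
  exact: (Pbvec (inr j)).
have : v \in <<codom x ++ codom y>>%VS.
  by case: xyB => /andP[/eqP-> _] _ _ _; rewrite memvf.
move=> /(@coord_span _ _ _ (in_tuple _)) ->.
elim/big_rec: _ => [|i u _ Pu]; first exact: P0.
by apply: PZD => //; apply/PX/mem_nth; case: i.
Qed.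

Lemma eq_coordinate u v : (forall a, coordinate a u = coordinate a v) -> u = v.
Proof.
move=> uv; rewrite (coordinate_sum u) (coordinate_sum v).
by apply: eq_bigr => a _; rewrite uv.
Qed.

Lemma sform_coordinate u v :
  sform u v =
  \sum_i (sform u (y i) * sform (x i) v - sform (x i) u * sform v (y i)).
Proof.
rewrite {1}(coordinate_sum u) linear_sumlz /= big_sumType [RHS]big_split /=.
congr (_ + _); apply: eq_bigr => i _; rewrite sformZl //.
by rewrite (sformC (y i)) mulrN.
Qed.

Lemma linear_ext (f : L -> F) :
  (forall k u v, f (k *: u + v) = k * f u + f v) ->
  (forall a, f (bvec x y a) = 0) -> forall v, f v = 0.
Proof.
move=> fZD f0 v; rewrite (coordinate_sum v).
elim/big_rec: _ => [|a u _ fu]; last by rewrite fZD f0 fu mulr0 addr0.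
by rewrite -(subrr v) -scaleN1r addrC fZD mulN1r addNr.
Qed.

End Coordinates.

(** * Presentations as trivectors *)

Lemma perm_eq3 (A : eqType) (a b c u v w : A) :
  perm_eq [:: a; b; c] [:: u; v; w] -> uniq [:: u; v; w] ->
  [:: u; v; w] \in [:: [:: a; b; c]; [:: a; c; b]; [:: b; a; c];
                       [:: b; c; a]; [:: c; a; b]; [:: c; b; a]].
Proof.
move=> peq; rewrite -(perm_uniq peq) /= !inE negb_or.
move=> /andP[/andP[/negPf ab /negPf ac] /andP[/negPf bc _]].
have memE := perm_mem peq; move: (memE a) (memE b) (memE c).
rewrite !inE !eqxx ?orbT /=.
by do 3!case/esym/or3P => /eqP ?; subst; rewrite ?eqxx ?orbT // in ab ac bc *.
Qed.

Definition entry_indices (F : fieldType) (q : bindex * bindex * bindex * F) :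
  seq bindex := [:: q.1.1.1; q.1.1.2; q.1.2].

(** No triple of basis vectors is listed twice, up to order, so the listed
    values can be prescribed independently. *)
Definition consistent (F : fieldType) (p : presentation F) :=
  all (fun q => uniq (entry_indices q)) p &&
  pairwise (fun q q' => ~~ perm_eq (entry_indices q) (entry_indices q')) p.

Section Presents.
Variables (F : fieldType) (L : saa F) (x y : 'I_5 -> L) (p : presentation F).
Hypothesis xyB : standard_basis x y.
Implicit Types (u v w : L) (a b c : bindex) (k : F).
Notation crd := (coordinate x y).
Notation bv := (bvec x y).

Lemma det3_bvec0 a b c a' b' c' :
  ~~ perm_eq [:: a; b; c] [:: a'; b'; c'] ->
  det3 (crd a) (crd b) (crd c) (bv a') (bv b') (bv c') = 0.
Proof.
move=> nperm.
have e0 (k1 k2 k3 : bindex) : perm_eq [:: k1; k2; k3] [:: a; b; c] ->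
    (k1 == a')%:R * ((k2 == b')%:R * (k3 == c')%:R) = 0 :> F.
  move=> kabc; do 3![case: eqP => [?|_]; last by rewrite !(mulr0, mul0r)].
  by subst; rewrite perm_sym kabc in nperm.
rewrite /det3 !(coordinate_bvec xyB).
(* Each of the six monomials compares one ordering of a, b, c with the triple
   a', b', c'; all six vanish by e0. *)
have -> (f1 f2 f3 g1 g2 g3 h1 h2 h3 : F) :
  f1 * (g2 * h3 - g3 * h2) - f2 * (g1 * h3 - g3 * h1) + f3 * (g1 * h2 - g2 * h1)
  = (f1 * (g2 * h3) - f1 * (h2 * g3)) - (g1 * (f2 * h3) - h1 * (f2 * g3))
    + (g1 * (h2 * f3) - h1 * (g2 * f3)) by ring.
by rewrite !e0 ?subrr ?addr0 //; apply/permP=> P /=; ring.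
Qed.

Lemma trivector_bvec0 a b c :
  (forall q, q \in p -> ~~ perm_eq (entry_indices q) [:: a; b; c]) ->
  trivector x y p (bv a) (bv b) (bv c) = 0.
Proof.
move=> np; rewrite /trivector big_seq big1 // => q qp.
by rewrite det3_bvec0 ?mulr0 //; apply: np qp.
Qed.

Lemma det3_bvec1 a b c : uniq [:: a; b; c] ->
  det3 (crd a) (crd b) (crd c) (bv a) (bv b) (bv c) = 1.
Proof.
rewrite /= !inE negb_or => /andP[/andP[/negPf ab /negPf ac] /andP[/negPf bc _]].
rewrite /det3 !(coordinate_bvec xyB) !eqxx.
by rewrite (eq_sym b a) (eq_sym c a) (eq_sym c b) ab ac bc /=; ring.
Qed.

Hypothesis pC : consistent p.

Lemma trivector_listed a b c k :
  (a, b, c, k) \in p -> trivector x y p (bv a) (bv b) (bv c) = k.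
Proof.
rewrite /trivector; case/andP: pC; elim: p => //= q p' IHp.
move=> /andP[qU p'U] /andP[qp' p'P]; rewrite inE big_cons => /predU1P[qE|abcp'].
  rewrite -qE /= in qU qp' *; rewrite det3_bvec1 // mulr1 big_seq.
  rewrite big1 ?addr0 // => q' /(allP qp').
  by rewrite perm_sym => /det3_bvec0->; rewrite mulr0.
by rewrite IHp // det3_bvec0 ?mulr0 ?add0r //; apply: (allP qp' _ abcp').
Qed.

(** Both sides are alternating and trilinear, and the listed and unlisted
    values of a presentation are exactly the values of its trivector on
    triples of distinct basis vectors.  This turns every verification of a
    presentation after a change of basis into one polynomial identity. *)
Lemma presentsP : presents p x y <->
  forall u v w, triple u v w = trivector x y p u v w.
Proof.
split=> [[listed unlisted] | tE]; last first.
  split=> [a b c k abcp | a b c _ np]; rewrite -/(triple _ _ _) tE.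
    exact: trivector_listed.
  by apply: trivector_bvec0 => -[[[a' b'] c'] k] /np.
pose D u v w := triple u v w - trivector x y p u v w.
have DZD k u1 u2 v w : D (k *: u1 + u2) v w = k * D u1 v w + D u2 v w.
  rewrite /D tripleZD mulrBr addrACA; congr (_ + _).
  rewrite mulr_sumr -opprD; congr (- _).
  rewrite -big_split; apply: eq_bigr => q _.
  by rewrite /det3 !coordinateZD /=; ring.
have Drot u v w : D u v w = D v w u.
  rewrite /D triple_rot; congr (_ - _); apply: eq_bigr => q _.
  by rewrite /det3; ring.
have DC u v w : D u v w = - D v u w.
  rewrite /D tripleC opprB addrC; congr (_ + _); rewrite -sumrN.
  by rewrite [LHS]/=; apply: eq_bigr => q _; rewrite /det3; ring.
suff D0 u v w : D u v w = 0.
  by move=> u v w; apply/eqP; rewrite -subr_eq0; apply/eqP/D0.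
apply: (@linear_ext _ _ _ _ xyB (fun u => D u v w)) => [|a].
  by move=> k u1 u2; apply: DZD.
rewrite Drot; apply: (@linear_ext _ _ _ _ xyB (fun v => D v w (bv a))) => [|b].
  by move=> k v1 v2; apply: DZD.
rewrite Drot.
apply: (@linear_ext _ _ _ _ xyB (fun w => D w (bv a) (bv b))) => [|c].
  by move=> k w1 w2; apply: DZD.
have Dvv u1 v1 : D u1 u1 v1 = 0.
  rewrite /D triplevv sub0r /trivector big1 ?oppr0 // => q _.
  by rewrite /det3; ring.
have [abcU|] := boolP (uniq [:: c; a; b]); last first.
  rewrite /= !inE andbT negb_and !negbK -orbA => /or3P[] /eqP->.
  - exact: Dvv.
  - by rewrite -Drot.
  - by rewrite Drot.
have [/hasP[[[[a' b'] c'] k] qp /perm_eq3]|/hasPn np] :=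
    boolP (has (fun q => perm_eq (entry_indices q) [:: c; a; b]) p); last first.
  rewrite /D trivector_bvec0 ?subr0; last exact: np.
  by apply: unlisted => // a' b' c' k /np.
have D0 : D (bv a') (bv b') (bv c') = 0.
  by rewrite /D (trivector_listed qp) [triple _ _ _](listed _ _ _ _ qp) subrr.
have DC0 : D (bv b') (bv a') (bv c') = 0 by rewrite DC D0 oppr0.
move=> /(_ abcU); rewrite !inE => /or4P[|||/or3P[]] /eqP[-> -> ->] //;
  by [rewrite Drot | rewrite -Drot].
Qed.

End Presents.

(** * Presentations and isomorphism *)

Section Transport.
Variable F : fieldType.

Lemma standard_basis_dim (L : saa F) (x y : 'I_5 -> L) :
  standard_basis x y -> \dim {:L} = 10%N.
Proof. by case=> /size_basis -> _ _ _; rewrite !card_ord. Qed.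

(** The Gram relations force freeness: pairing a vanishing combination with
    the dual basis vector isolates each coefficient. *)
Lemma standard_basisP (L : saa F) (x y : 'I_5 -> L) : \dim {:L} = 10%N ->
  (forall i j, sform (x i) (x j) = 0) -> (forall i j, sform (y i) (y j) = 0) ->
  (forall i j, sform (x i) (y j) = (i == j)%:R) -> standard_basis x y.
Proof.
move=> dimL xx yy xy; split=> //.
rewrite basisEfree subvf dimL size_cat !size_codom !card_ord /= andbT.
have -> : codom x ++ codom y = codom (bvec x y).
  rewrite /codom /image_mem ![enum _]enumT.
  by rewrite [in RHS]unlock /= /sum_enum map_cat -!map_comp.
apply/(@freeP _ _ _ (codom_tuple (bvec x y))) => k k0 j.
have crd_bv a b : coordinate x y a (bvec x y b) = (a == b)%:R.
  case: a b => i [l|l] /=; rewrite ?xx ?yy ?xy //.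
  by rewrite eq_sym.
have := coordinate_lincomb x y (enum_val j) k (fun i => (codom (bvec x y))`_i).
rewrite k0 (bigD1 j) //= nth_codom crd_bv eqxx mulr1.
rewrite big1 ?addr0 => [<-|i ij].
  by case: (enum_val j) => l; rewrite /= ?sform0l ?sform0r.
by rewrite nth_codom crd_bv (inj_eq enum_val_inj) eq_sym (negPf ij) mulr0.
Qed.

Lemma has_presentation_iso (L M : saa F) (p : presentation F) :
  saa_iso L M -> has_presentation L p -> has_presentation M p.
Proof.
case=> f [[g fK gK] fform fmul] [x [y [xyB [listed unlisted]]]].
have dimM : \dim {:M} = 10%N.
  rewrite -(standard_basis_dim xyB) -(@limg_dim_eq _ _ _ (linfun f)).
    congr (\dim _); apply/eqP; rewrite eqEsubv subvf andbT.
    by apply/subvP=> v _; rewrite -(gK v) -(lfunE f) memv_img ?memvf.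
  apply/eqP; rewrite -subv0; apply/subvP=> v /memv_capP[_].
  rewrite memv_ker memv0 lfunE /= -{2}(fK v) => /eqP->.
  by rewrite -(fK 0) linear0.
exists (f \o x), (f \o y); split.
  case: xyB => _ xx yy xy.
  by apply: standard_basisP => // i j; rewrite /= fform.
have bvE a : bvec (f \o x) (f \o y) a = f (bvec x y a) by case: a.
split=> [a b c k|a b c]; rewrite !bvE -fmul fform; first exact: listed.
exact: unlisted.
Qed.

(** The linear map matching the two standard bases preserves the form and the
    trivector; the product is determined by these, as the form is
    nondegenerate. *)
Lemma saa_iso_presentation (L M : saa F) (p : presentation F) : consistent p ->
  has_presentation L p -> has_presentation M p -> saa_iso L M.
Proof.
move=> pC [x [y [xyB /(presentsP xyB pC) tL]]].
move=> [x' [y' [xyB' /(presentsP xyB' pC) tM]]].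
pose change (N N' : saa F) (z t : 'I_5 -> N) (z' t' : 'I_5 -> N') (v : N) :=
  \sum_a coordinate z t a v *: bvec z' t' a.
have changeE (N N' : saa F) (z t : 'I_5 -> N) (z' t' : 'I_5 -> N') a v :
    standard_basis z' t' ->
    coordinate z' t' a (change N N' z t z' t' v) = coordinate z t a v.
  move=> ztB; rewrite coordinate_lincomb (bigD1 a) //= coordinate_bvec // eqxx.
  rewrite mulr1 big1 ?addr0 // => b ba.
  by rewrite coordinate_bvec // eq_sym (negPf ba) mulr0.
pose f := change L M x y x' y'; pose g := change M L x' y' x y.
have fK : cancel f g.
  by move=> v; apply: (eq_coordinate xyB) => a; rewrite !changeE.
have gK : cancel g f.
  by move=> v; apply: (eq_coordinate xyB') => a; rewrite !changeE.
have f_linear : linear f.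
  move=> k u v; apply: (eq_coordinate xyB') => a.
  by rewrite coordinateZD !changeE // coordinateZD.
have fform u v : sform (f u) (f v) = sform u v.
  rewrite (sform_coordinate xyB') (sform_coordinate xyB).
  have crdE b w := changeE L M x y x' y' b w xyB'.
  apply: eq_bigr => i _; congr (_ * _ - _ * _); by [exact: (crdE (inl i))
    | exact: (crdE (inr i)) | exact: (crdE (inr i)) | exact: (crdE (inl i))].
pose fL : {linear L -> M} :=
  HB.pack f (GRing.isLinear.Build F L M *:%R f f_linear).
exists fL.
split=> //; first by exists g.
move=> u v; apply/eqP; rewrite -subr_eq0; apply/eqP/sform_nondeg => w.
rewrite -scaleN1r addrC sformDl sformZl mulN1r -(gK w) fform.
rewrite -!/(triple _ _ _) tL tM /trivector addrC; apply/eqP; rewrite subr_eq0.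
by apply/eqP; apply: eq_bigr => q _; rewrite /det3 !changeE.
Qed.

End Transport.

(** * Changing the parameters of the presentation *)

Section Families.
Variable V : Type.

Definition fam5 (v1 v2 v3 v4 v5 : V) (i : 'I_5) : V :=
  nth v1 [:: v1; v2; v3; v4; v5] i.

Lemma fam5E v1 v2 v3 v4 v5 (v := fam5 v1 v2 v3 v4 v5) :
  ((v (idx 1) = v1) * (v (idx 2) = v2) * (v (idx 3) = v3) *
   (v (idx 4) = v4) * (v (idx 5) = v5))%type.
Proof. by []. Qed.

End Families.

Lemma idx_ind (P : 'I_5 -> Prop) :
  P (idx 1) -> P (idx 2) -> P (idx 3) -> P (idx 4) -> P (idx 5) ->
  forall i, P i.
Proof.
move=> P1 P2 P3 P4 P5 [[|[|[|[|[|//]]]]] lti].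
- by rewrite (_ : Ordinal lti = idx 1) //; apply: val_inj.
- by rewrite (_ : Ordinal lti = idx 2) //; apply: val_inj.
- by rewrite (_ : Ordinal lti = idx 3) //; apply: val_inj.
- by rewrite (_ : Ordinal lti = idx 4) //; apply: val_inj.
- by rewrite (_ : Ordinal lti = idx 5) //; apply: val_inj.
Qed.

(* Only comparisons of explicit indices are evaluated: reducing an equality
   test in the abstract field F would unfold its structure. *)
Ltac compute_eqs :=
  repeat match goal with |- context [@eq_op ?A (idx ?a) (idx ?b)] =>
    let c := eval vm_compute in (@eq_op A (idx a) (idx b)) in
    change (@eq_op A (idx a) (idx b)) with c
  end.

Lemma P_10_3_8_consistent (F : fieldType) (r s : F) : consistent (P_10_3_8 r s).
Proof. by vm_compute. Qed.

Lemma P_10_3_8_presentsP (F : fieldType) (L : saa F) (x y : 'I_5 -> L) (r s : F) :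
  standard_basis x y ->
  presents (P_10_3_8 r s) x y <->
  forall u v w, triple u v w = trivector x y (P_10_3_8 r s) u v w.
Proof. by move=> xyB; apply: presentsP (P_10_3_8_consistent r s). Qed.

Lemma P_10_3_8E (F : fieldType) (L : saa F) (x y : 'I_5 -> L) (r s : F) u v w :
  let T i j k :=
    det3 (coordinate x y i) (coordinate x y j) (coordinate x y k) u v w in
  trivector x y (P_10_3_8 r s) u v w =
    r * T (ix 2) (iy 4) (iy 5) + s * T (ix 1) (iy 3) (iy 5)
    + T (ix 1) (iy 2) (iy 4) + T (iy 1) (iy 2) (iy 5) + T (iy 1) (iy 3) (iy 4).
Proof.
move=> T; rewrite /trivector /P_10_3_8 !big_cons big_nil /=.
by rewrite addr0 !mul1r !addrA.
Qed.

Definition sform_basisE (F : fieldType) (L : saa F) (x y : 'I_5 -> L)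
    (xyB : standard_basis x y) :=
  (sform_xx xyB, sform_yy xyB, sform_xy xyB, sform_yx xyB).

(* Reduces a Gram relation between two families of combinations of the standard
   basis xyB to scalar identities, one for each pair of indices. *)
Ltac gram xyB := apply: idx_ind; apply: idx_ind;
  rewrite !fam5E ?sformE ?(sform_basisE xyB); compute_eqs; rewrite /=.

(** Let t be a square root of s, acting on the plane of x1 and y1 by t y1 = x1
    and t x1 = s y1.  The new y1 is u y1 with u = a + b t, of norm n, and the
    new y2 is c y2; the rest is forced.  The vectors x5 and x4 are the products
    of y1 by y2 and y3, the vector x1 is determined by x1 y2 = x4, which makes
    it a multiple of u x1, and y3 is scaled so that x1 and y1 pair to 1. *)
Lemma P_10_3_8_rescale (F : fieldType) (L : saa F) (r s a b c : F)
    (x y : 'I_5 -> L) (n := a ^+ 2 - b ^+ 2 * s) :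
  standard_basis x y -> presents (P_10_3_8 r s) x y ->
  c != 0 -> n != 0 ->
  has_presentation L (P_10_3_8 (r / c ^+ 3) (s / n ^+ 2)).
Proof.
move=> xyB /(P_10_3_8_presentsP _ _ xyB) tE c0 n0.
pose x' := fam5 (n^-1 *: (a *: x (idx 1) + (b * s) *: y (idx 1)))
  (c^-1 *: x (idx 2)) ((n / c) *: x (idx 3))
  ((c / n) *: (a *: x (idx 4) + (b * s) *: x (idx 5)))
  (c *: (b *: x (idx 4) + a *: x (idx 5))).
pose y' := fam5 (b *: x (idx 1) + a *: y (idx 1)) (c *: y (idx 2))
  ((c / n) *: y (idx 3)) (c^-1 *: (a *: y (idx 4) + (- b) *: y (idx 5)))
  ((c * n)^-1 *: (a *: y (idx 5) + (- b * s) *: y (idx 4))).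
exists x', y'.
have x'y'B : standard_basis x' y'.
  rewrite /x' /y'; apply: standard_basisP; first exact: standard_basis_dim xyB.
  - by gram xyB; ring.
  - by gram xyB; ring.
  - by gram xyB; rewrite /n in n0 *; field; rewrite ?c0 ?n0.
split=> //; apply/(P_10_3_8_presentsP _ _ x'y'B) => u v w.
rewrite tE !P_10_3_8E /det3 /coordinate /= /x' /y' !fam5E !sformE.
rewrite !(sformC (y _)) !(sformC _ (x _)) /n in n0 *.
by field; rewrite n0 c0.
Qed.

(** * Invariance of the parameters *)

Section Invariants.
Variables (F : fieldType) (L : saa F) (x y : 'I_5 -> L) (r s : F).
Hypotheses (xyB : standard_basis x y) (xyP : presents (P_10_3_8 r s) x y).
Hypotheses (r0 : r != 0).
Notation X k := (x (idx k)).
Notation Y k := (y (idx k)).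

Let tE u v w : triple u v w = trivector x y (P_10_3_8 r s) u v w.
Proof. exact: (iffLR (P_10_3_8_presentsP _ _ xyB)). Qed.

(* Evaluates triples some of whose entries are basis vectors. *)
Ltac basis_triples := rewrite !tE !P_10_3_8E /det3 /coordinate /=
   ?(sform_basisE xyB); compute_eqs; rewrite /=.

(** The centre is spanned by x3, x4, x5; the condition on v is the vanishing of
    its other seven coordinates. *)
Lemma centreP v : v \in ucs L 1 <->
  [/\ sform v (Y 1) = 0, sform v (Y 2) = 0 & forall k, sform (x k) v = 0].
Proof.
split=> [/memv_ucsS vZ | [v1 v2 vx]]; last first.
  apply/memv_ucsS => u; rewrite memv0 smul_eq0 // => {}u w.
  by rewrite tE P_10_3_8E /det3 /coordinate /= v1 v2 !vx; ring.
have {vZ} t0 u w : triple v u w = 0.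
  by have := vZ u; rewrite memv0 => /eqP; rewrite /triple => ->; apply: sform0l.
(* Each coordinate of v is, up to a factor r, one triple of v with two basis
   vectors. *)
split.
- by rewrite -(t0 (Y 2) (Y 4)); basis_triples; ring.
- by apply: (mulfI r0); rewrite mulr0 -(t0 (Y 4) (Y 5)); basis_triples; ring.
apply: idx_ind.
- by rewrite -(t0 (Y 2) (Y 5)); basis_triples; ring.
- by rewrite -(t0 (Y 4) (X 1)); basis_triples; ring.
- by rewrite -(t0 (Y 4) (Y 1)); basis_triples; ring.
- by rewrite -(t0 (X 1) (Y 2)); basis_triples; ring.
- by rewrite -(t0 (Y 1) (Y 2)); basis_triples; ring.
Qed.

Lemma mem_centre k : (2 < k < 6)%N -> X k \in ucs L 1.
Proof.
move=> k35; apply/centreP; rewrite !(sform_basisE xyB).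
split=> [||i]; rewrite ?(sform_basisE xyB) //.
all: by move: k k35 => [|[|[|[|[|[|//]]]]]].
Qed.

(** Together with [mem_ucs2] this says that the second centre is spanned by
    x2, ..., x5, as its elements have no coordinate on x1 and on any y. *)
Lemma ucs2_coordinate v : v \in ucs L 2 ->
  sform v (Y 1) = 0 /\ forall k, sform (x k) v = 0.
Proof.
move/memv_ucsS => vZ.
have t0 u : [/\ triple v u (Y 1) = 0, triple v u (Y 2) = 0
              & forall k, triple v u (x k) = 0].
  have /centreP[v1 v2 vx] := vZ u; split=> // k.
  by rewrite /triple sformC vx oppr0.
have t1 u := let: And3 t _ _ := t0 u in t.
have t2 u := let: And3 _ t _ := t0 u in t.
have tx u := let: And3 _ _ t := t0 u in t.
split; first by apply: oppr_inj; rewrite oppr0 -(t2 (Y 4)); basis_triples; ring.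
apply: idx_ind.
- by apply: oppr_inj; rewrite oppr0 -(t2 (Y 5)); basis_triples; ring.
- by rewrite -(tx (Y 4) (idx 1)); basis_triples; ring.
- by rewrite -(t1 (Y 4)); basis_triples; ring.
- by rewrite -(t2 (X 1)); basis_triples; ring.
- by rewrite -(t2 (Y 1)); basis_triples; ring.
Qed.

Lemma mem_ucs2 k : (1 < k < 6)%N -> X k \in ucs L 2.
Proof.
move=> k25; apply/memv_ucsS => u; apply/centreP.
have t0 a : a \in [:: ix 1; ix 2; ix 3; ix 4; ix 5; iy 1; iy 2] ->
    triple (X k) u (bvec x y a) = 0.
  move: k k25 => [|[|[|[|[|[|//]]]]]] // _; rewrite !inE;
    do ?[case/orP]; move=> /eqP->; rewrite /=; basis_triples; ring.
split; [exact: (t0 (iy 1)) | exact: (t0 (iy 2)) |].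
by apply: idx_ind; rewrite sformC; apply/eqP; rewrite oppr_eq0; apply/eqP;
  [exact: (t0 (ix 1)) | exact: (t0 (ix 2)) | exact: (t0 (ix 3))
  | exact: (t0 (ix 4)) | exact: (t0 (ix 5))].
Qed.

(** The annihilator of the second centre is the space orthogonal to x4 and x5:
    it contains y3 but no vector with a coordinate on y4 or y5.  This separates
    the y3 of one presenting basis from the y4 and y5 of another. *)
Lemma triple_ucs2_y3 z w : z \in ucs L 2 -> triple z (Y 3) w = 0.
Proof.
by case/ucs2_coordinate => z1 zx; basis_triples; rewrite z1 !zx; ring.
Qed.

Lemma annihilator_ucs2 v : (forall z w, z \in ucs L 2 -> triple z v w = 0) ->
  sform (X 4) v = 0 /\ sform (X 5) v = 0.
Proof.
move=> t0; split; apply: (mulfI r0); rewrite mulr0.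
  by rewrite -(t0 (X 2) (Y 5)) ?mem_ucs2 //; basis_triples; ring.
apply: oppr_inj; rewrite oppr0 -(t0 (X 2) (Y 4)) ?mem_ucs2 //.
by basis_triples; ring.
Qed.

End Invariants.

(** The equations that relate two bases presenting the same algebra.  Modulo the
    second centre, y1' = a y1 + b x1 and x1' = a' x1 + b' y1; modulo L^3,
    y2' = c y2 and y3' = d y3 + e y2; k is the coefficient of x2 in x2', and
    gij that of yj in yi'.  The first four triples invert the matrix of
    (x1', y1') and so express the gij.  Comparing the triples of y3' then gives
    e = 0 (this is the trace of tau, and needs 2 <> 0) and a b' = a' b s, after
    which the multiplicativity of the norm a^2 - b^2 s yields the relation of s
    and s'. *)
Lemma parameters_relation (F : fieldType)
    (a a' b b' c d e k g44 g45 g54 g55 r r' s s' : F) :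
  2%N \notin [pchar F] -> k * c = 1 -> a * a' - b * b' = 1 ->
  c * (a' * g44 + b' * g45) = 1 -> c * (a' * g54 + b' * g55) = 0 ->
  c * (b * g44 + a * g45) = 0 -> c * (b * g54 + a * g55) = 1 ->
  e * (b * g44 + a * g45) + d * (b * s * g45 + a * g44) = 1 ->
  e * (b * g54 + a * g55) + d * (b * s * g55 + a * g54) = 0 ->
  e * (a' * g44 + b' * g45) + d * (a' * s * g45 + b' * g44) = 0 ->
  e * (a' * g54 + b' * g55) + d * (a' * s * g55 + b' * g54) = s' ->
  r' = k * r * (g44 * g55 - g45 * g54) ->
  [/\ c != 0, r' = r / c ^+ 3 & s = s' * (a ^+ 2 - b ^+ 2 * s) ^+ 2].
Proof.
move=> char2 kc det1 E1 E2 E3 E4 E5 E6 E7 E8 E9.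
have /andP[k0 c0] : (k != 0) && (c != 0).
  by rewrite -negb_or -mulf_eq0 kc oner_eq0.
have kE : k = c^-1 by apply: (mulIf c0); rewrite kc mulVf.
(* Cramer's rule for the system with matrix c [[a', b'], [b, a]]. *)
have cramer u v p q : c * (a' * u + b' * v) = p -> c * (b * u + a * v) = q ->
    u = (a * p - b' * q) * k /\ v = (a' * q - b * p) * k.
  move=> <- <-; split.
    transitivity (u * (a * a' - b * b') * (k * c)); last by ring.
    by rewrite det1 kc !mulr1.
  transitivity (v * (a * a' - b * b') * (k * c)); last by ring.
  by rewrite det1 kc !mulr1.
have [g44E g45E] := cramer _ _ _ _ E1 E3.
have [g54E g55E] := cramer _ _ _ _ E2 E4.
rewrite !(mulr1, mulr0, subr0, sub0r) in g44E g45E g54E g55E.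
rewrite {}g44E {}g45E {}g54E {}g55E in E5 E6 E7 E8 E9 *.
have two0 : 2%:R != 0 :> F by move: char2; rewrite inE.
have e0 : e = 0.
  apply: (mulfI two0); apply: (mulIf k0).
  rewrite mulr0 mul0r -[in RHS](addr0 0) -{1}E6 -E7.
  transitivity (2%:R * e * k * (a * a' - b * b')); first by rewrite det1 mulr1.
  by ring.
have d0 : d != 0.
  by apply: contra_eq_neq E5 => ->; rewrite e0 !mul0r addr0 eq_sym oner_eq0.
have cross : a * b' = a' * b * s.
  apply: (mulfI d0); apply: (mulIf k0); apply/eqP; rewrite -subr_eq0; apply/eqP.
  by rewrite -E7 e0; ring.
split=> //.
  rewrite E9 kE; transitivity (r * (a * a' - b * b') / c ^+ 3); first by field.
  by rewrite det1 mulr1.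
transitivity (s * (a * a' - b * b') ^+ 2 - (a * b' - a' * b * s) ^+ 2).
  by rewrite det1 cross; ring.
transitivity ((a' ^+ 2 * s - b' ^+ 2) * (a ^+ 2 - b ^+ 2 * s) * 1).
  by ring.
by rewrite -E5 -E8 e0; ring.
Qed.

Lemma sum_idx (V : nmodType) (f : 'I_5 -> V) :
  \sum_i f i = f (idx 1) + f (idx 2) + f (idx 3) + f (idx 4) + f (idx 5).
Proof.
rewrite !big_ord_recr big_ord0 /= add0r.
by congr (f _ + f _ + f _ + f _ + f _); apply: val_inj.
Qed.

(** The centre, the second centre and the annihilator of the second centre do
    not depend on the basis, so two presenting bases are related by a block
    triangular matrix; its diagonal blocks satisfy [parameters_relation]. *)
Lemma presentation_parameters (F : fieldType) (L : saa F)
    (x y x' y' : 'I_5 -> L) (r s r' s' : F) :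
  2%N \notin [pchar F] -> r != 0 -> r' != 0 ->
  standard_basis x y -> presents (P_10_3_8 r s) x y ->
  standard_basis x' y' -> presents (P_10_3_8 r' s') x' y' ->
  exists a b c,
    [/\ c != 0, r' = r / c ^+ 3 & s = s' * (a ^+ 2 - b ^+ 2 * s) ^+ 2].
Proof.
move=> char2 r0 r'0 xyB xyP xyB' xyP'.
have tE := iffLR (P_10_3_8_presentsP _ _ xyB) xyP.
have tE' := iffLR (P_10_3_8_presentsP _ _ xyB') xyP'.
have [y3_4 y3_5] : sform (x (idx 4)) (y' (idx 3)) = 0 /\
                   sform (x (idx 5)) (y' (idx 3)) = 0.
  apply: (annihilator_ucs2 xyB xyP r0) => z w zZ.
  exact: (triple_ucs2_y3 xyB' xyP' r'0).
have y2x k : (2 < k < 6)%N -> sform (x (idx k)) (y' (idx 2)) = 0.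
  by move=> k36; have /(centreP xyB' xyP' r'0)[] := mem_centre xyB xyP r0 k36.
have xZ2 k (k26 : (1 < k < 6)%N) :=
  ucs2_coordinate xyB' xyP' r'0 (mem_ucs2 xyB xyP r0 k26).
have y1x k : (1 < k < 6)%N -> sform (x (idx k)) (y' (idx 1)) = 0.
  by case/xZ2.
have x1x k : (1 < k < 6)%N -> sform (x (idx k)) (x' (idx 1)) = 0.
  by case/xZ2 => _ xk; rewrite sformC xk oppr0.
have /(ucs2_coordinate xyB xyP r0)[x2y1 x2x] :=
  mem_ucs2 xyB' xyP' r'0 (isT : 1 < 2 < 6)%N.
have vanish := (y3_4, y3_5, y2x 3%N isT, y2x 4%N isT, y2x 5%N isT,
  y1x 2%N isT, y1x 3%N isT, y1x 4%N isT, y1x 5%N isT,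
  x1x 2%N isT, x1x 3%N isT, x1x 4%N isT, x1x 5%N isT, x2y1, x2x).
have two_ways u v w : trivector x y (P_10_3_8 r s) u v w =
    trivector x' y' (P_10_3_8 r' s') u v w by rewrite -tE.
have {}two_ways i j k :=
  two_ways (bvec x' y' i) (bvec x' y' j) (bvec x' y' k).
have xy1 := sform_xy xyB' (idx 1) (idx 1).
have xy2 := sform_xy xyB' (idx 2) (idx 2).
rewrite (sform_coordinate xyB) sum_idx !vanish eqxx in xy1.
rewrite (sform_coordinate xyB) sum_idx !vanish eqxx in xy2.
rewrite !(mulr0, mul0r, oppr0, addr0, add0r) in xy1 xy2.
(* The witnesses are the coefficients of y1' on y1 and x1, and of y2' on y2. *)
exists (sform (x (idx 1)) (y' (idx 1))), (sform (y' (idx 1)) (y (idx 1))),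
  (sform (x (idx 2)) (y' (idx 2))).
apply: (@parameters_relation _
  _ (sform (x' (idx 1)) (y (idx 1))) _ (sform (x (idx 1)) (x' (idx 1)))
  _ (sform (x (idx 3)) (y' (idx 3))) (sform (x (idx 2)) (y' (idx 3)))
  (sform (x' (idx 2)) (y (idx 2)))
  (sform (x (idx 4)) (y' (idx 4))) (sform (x (idx 5)) (y' (idx 4)))
  (sform (x (idx 4)) (y' (idx 5))) (sform (x (idx 5)) (y' (idx 5)))) => //.
all: rewrite ?xy2 //.
  by rewrite -[RHS]xy1; congr (_ - _); apply: mulrC.
all: [> have := two_ways (ix 1) (iy 2) (iy 4)
  | have := two_ways (ix 1) (iy 2) (iy 5)
  | have := two_ways (iy 1) (iy 2) (iy 4)
  | have := two_ways (iy 1) (iy 2) (iy 5)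
  | have := two_ways (iy 1) (iy 3) (iy 4)
  | have := two_ways (iy 1) (iy 3) (iy 5)
  | have := two_ways (ix 1) (iy 3) (iy 4)
  | have := two_ways (ix 1) (iy 3) (iy 5)
  | have := two_ways (ix 2) (iy 4) (iy 5)].
all: rewrite !P_10_3_8E /det3 /coordinate /= !vanish !(sform_basisE xyB').
all: compute_eqs; rewrite /= => E.
all: [> apply: etrans (etrans _ E) _ ..
  | apply: etrans (etrans _ (esym E)) _]; ring.
Qed.

(** * The presentation of an adapted basis *)

Section AdaptedPresentation.
Variable F : fieldType.

(** The fifteen triples that the central series of an adapted basis leaves free.
    The matrices p and q are those of phi and psi on the basis x1, y1 of
    L^3/L^4 and the basis x4, x5 of L^5. *)
Definition adapted_presentation
    (r p11 p12 p21 p22 q11 q12 q21 q22 a1 a2 b4 b5 c d : F) : presentation F :=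
  [:: (ix 2, iy 4, iy 5, r);
      (ix 1, iy 2, iy 4, p11); (ix 1, iy 2, iy 5, p12);
      (iy 1, iy 2, iy 4, p21); (iy 1, iy 2, iy 5, p22);
      (ix 1, iy 3, iy 4, q11); (ix 1, iy 3, iy 5, q12);
      (iy 1, iy 3, iy 4, q21); (iy 1, iy 3, iy 5, q22);
      (ix 1, iy 4, iy 5, a1); (iy 1, iy 4, iy 5, a2);
      (iy 2, iy 3, iy 4, b4); (iy 2, iy 3, iy 5, b5);
      (iy 2, iy 4, iy 5, c); (iy 3, iy 4, iy 5, d)].

Lemma adapted_presentation_consistent
    r p11 p12 p21 p22 q11 q12 q21 q22 a1 a2 b4 b5 c d :
  consistent
    (adapted_presentation r p11 p12 p21 p22 q11 q12 q21 q22 a1 a2 b4 b5 c d).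
Proof. by vm_compute. Qed.

Lemma adapted_presentsP (L : saa F) (x y : 'I_5 -> L)
    r p11 p12 p21 p22 q11 q12 q21 q22 a1 a2 b4 b5 c d
    (p := adapted_presentation
            r p11 p12 p21 p22 q11 q12 q21 q22 a1 a2 b4 b5 c d) :
  standard_basis x y ->
  presents p x y <-> forall u v w, triple u v w = trivector x y p u v w.
Proof. by move=> xyB; apply/presentsP/adapted_presentation_consistent. Qed.

Lemma adapted_presentationE (L : saa F) (x y : 'I_5 -> L)
    r p11 p12 p21 p22 q11 q12 q21 q22 a1 a2 b4 b5 c d u v w :
  let T i j k :=
    det3 (coordinate x y i) (coordinate x y j) (coordinate x y k) u v w in
  trivector x y
    (adapted_presentation r p11 p12 p21 p22 q11 q12 q21 q22 a1 a2 b4 b5 c d)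
    u v w =
  r * T (ix 2) (iy 4) (iy 5)
  + p11 * T (ix 1) (iy 2) (iy 4) + p12 * T (ix 1) (iy 2) (iy 5)
  + p21 * T (iy 1) (iy 2) (iy 4) + p22 * T (iy 1) (iy 2) (iy 5)
  + q11 * T (ix 1) (iy 3) (iy 4) + q12 * T (ix 1) (iy 3) (iy 5)
  + q21 * T (iy 1) (iy 3) (iy 4) + q22 * T (iy 1) (iy 3) (iy 5)
  + a1 * T (ix 1) (iy 4) (iy 5) + a2 * T (iy 1) (iy 4) (iy 5)
  + b4 * T (iy 2) (iy 3) (iy 4) + b5 * T (iy 2) (iy 3) (iy 5)
  + c * T (iy 2) (iy 4) (iy 5) + d * T (iy 3) (iy 4) (iy 5).
Proof.
move=> T; rewrite /trivector /adapted_presentation !big_cons big_nil addr0.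
by rewrite !addrA.
Qed.

End AdaptedPresentation.

Definition central_index (a : bindex) := a \in [:: ix 3; ix 4; ix 5].

(** The basis vectors that lie in L^3. *)
Definition cube_index (a : bindex) :=
  a \in [:: ix 1; ix 2; ix 3; ix 4; ix 5; iy 1].

(** The basis vectors orthogonal to L^5. *)
Definition orth5_index (a : bindex) := a \notin [:: iy 4; iy 5].

(** The four cases come from Z(L) L = 0, from L^4 L = L^5, from the inclusion of
    Z_3(L) L in Z_2(L), which is orthogonal to L^3, and from L^3 L^2 = L^5. *)
Definition vanishing (a b c : bindex) :=
  [|| central_index a, (a == ix 2) && orth5_index b,
      cube_index a && cube_index b |
      [&& cube_index a, b == iy 2 & c == iy 3]].

Definition bindices : seq bindex :=
  [:: ix 1; ix 2; ix 3; ix 4; ix 5; iy 1; iy 2; iy 3; iy 4; iy 5].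

(** A finite check: the statement is decided on all triples of basis vectors. *)
Lemma vanishing_or_listed (F : fieldType)
    (r p11 p12 p21 p22 q11 q12 q21 q22 a1 a2 b4 b5 c d : F) (i j k : bindex) :
  uniq [:: i; j; k] ->
  [|| vanishing i j k, vanishing j k i, vanishing k i j,
      vanishing j i k, vanishing i k j | vanishing k j i] ||
  has (fun q => perm_eq (entry_indices q) [:: i; j; k])
    (adapted_presentation r p11 p12 p21 p22 q11 q12 q21 q22 a1 a2 b4 b5 c d).
Proof.
apply/implyP; move: i j k.
suff all3 P :
    all (fun i => all (fun j => all (P i j) bindices) bindices) bindices ->
    forall i j k, P i j k.
  by apply: (all3 (fun i j k => _ ==> _)); vm_compute.
move=> + i j k; have memb l : l \in bindices by case: l; apply: idx_ind.
by move=> /allP/(_ i (memb i))/allP/(_ j (memb j))/allP/(_ k (memb k)).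
Qed.

Section Adapted.
Variables (F : fieldType) (L : saa F) (x y : 'I_5 -> L).
Hypothesis xyA : adapted x y.
Hypothesis L3L2 : sprod (lcs L 3) (lcs L 2) = lcs L 5.
Notation X k := (x (idx k)).
Notation Y k := (y (idx k)).
Notation bv := (bvec x y).

Let xyB : standard_basis x y. Proof. by case: xyA. Qed.

Lemma adapted_mem :
  [/\ forall a, central_index a -> bv a \in centre L,
      X 2 \in lcs L 4 & forall a, cube_index a -> bv a \in lcs L 3].
Proof.
case: xyA => _ E5 EZ [_ E4] [_ E3 _ _].
have s5Z : (lcs L 5 <= centre L)%VS by rewrite EZ addvSl.
have sZ4 : (centre L <= lcs L 4)%VS by rewrite E4 addvSl.
have s43 : (lcs L 4 <= lcs L 3)%VS by rewrite E3 -addvA addvSl.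
have central a : central_index a -> bv a \in centre L.
  rewrite /central_index !inE => /or3P[] /eqP-> /=.
  - by rewrite memvE EZ addvSr.
  - by apply/(subvP s5Z); rewrite memvE E5 addvSr.
  - by apply/(subvP s5Z); rewrite memvE E5 addvSl.
have X2 : X 2 \in lcs L 4 by rewrite memvE E4 addvSr.
split=> // a; rewrite /cube_index !inE => /orP[/eqP->|/orP[/eqP->|]].
- by rewrite memvE E3 (subv_trans _ (addvSl _ _)) ?addvSr.
- exact: (subvP s43).
rewrite !orbA => /orP[aZ|/eqP->]; last by rewrite memvE E3 addvSr.
apply/(subvP s43)/(subvP sZ4)/central.
by rewrite /central_index !inE -orbA in aZ *.
Qed.

Lemma sform_lcs5 v a : v \in lcs L 5 -> orth5_index a -> sform v (bv a) = 0.
Proof.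
case: xyA => _ -> _ _ _ /memv_addP[_ /vlineP[k5 ->] [_ /vlineP[k4 ->] ->]].
by case: a; apply: idx_ind => // _;
  rewrite /= !sformE !(sform_basisE xyB); compute_eqs; rewrite /=; ring.
Qed.

Lemma sform_ucs2 v a : v \in ucs L 2 -> cube_index a -> sform v (bv a) = 0.
Proof.
case: xyA => _ E5 EZ [-> ->] _; rewrite EZ E5.
case/memv_addP=> _ /memv_addP[_ /memv_addP[_ /vlineP[k5 ->]
  [_ /vlineP[k4 ->] ->]] [_ /vlineP[k3 ->] ->]] [_ /vlineP[k2 ->] ->].
by case: a; apply: idx_ind => // _;
  rewrite /= !sformE !(sform_basisE xyB); compute_eqs; rewrite /=; ring.
Qed.

Lemma triple_vanishing a b c :
  vanishing a b c -> triple (bv a) (bv b) (bv c) = 0.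
Proof.
have [aZ X2 aL3] := adapted_mem.
case: xyA => _ E5 EZ [E24 E4] [E33 E3 E2 _].
case/or4P=> [/aZ | /andP[/eqP-> b5] | /andP[/aL3 + b3]
            | /and3P[/aL3 a3 /eqP-> /eqP->]].
- move=> /(@memv_ucsS _ _ 0 (bv a))/(_ (bv b)); rewrite memv0 => /eqP.
  by rewrite /triple => ->; apply: sform0l.
- by rewrite tripleCr /triple sform_lcs5 ?oppr0 // memv_sprod ?memvf.
- rewrite -E33 => /memv_ucsS/(_ (bv c)) acZ.
  by rewrite tripleCr /triple sform_ucs2 ?oppr0.
rewrite /triple sform_lcs5 // -L3L2 memv_sprod //.
by rewrite memvE E2 addvSr.
Qed.

(** The listed values are the triples themselves, so the content is that all
    other triples vanish. *)
Lemma presents_adapted :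
  presents (adapted_presentation (triple (X 2) (Y 4) (Y 5))
    (triple (X 1) (Y 2) (Y 4)) (triple (X 1) (Y 2) (Y 5))
    (triple (Y 1) (Y 2) (Y 4)) (triple (Y 1) (Y 2) (Y 5))
    (triple (X 1) (Y 3) (Y 4)) (triple (X 1) (Y 3) (Y 5))
    (triple (Y 1) (Y 3) (Y 4)) (triple (Y 1) (Y 3) (Y 5))
    (triple (X 1) (Y 4) (Y 5)) (triple (Y 1) (Y 4) (Y 5))
    (triple (Y 2) (Y 3) (Y 4)) (triple (Y 2) (Y 3) (Y 5))
    (triple (Y 2) (Y 4) (Y 5)) (triple (Y 3) (Y 4) (Y 5))) x y.
Proof.
split=> [a b c k|a b c abcU].
  rewrite /adapted_presentation !inE => abc.
  by repeat (case/orP: abc => abc); case/eqP: abc => -> -> -> ->.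
set p := adapted_presentation _ _ _ _ _ _ _ _ _ _ _ _ _ _ _ => unlisted.
rewrite -/(triple _ _ _).
have : ~~ has (fun q => perm_eq (entry_indices q) [:: a; b; c]) p.
  by apply/hasPn => -[[[a' b'] c'] k] /unlisted.
have : is_true (_ || has _ p) :=
  vanishing_or_listed _ _ _ _ _ _ _ _ _ _ _ _ _ _ _ abcU.
case/orP; last by move=> listed /negP[].
have swap u v w : triple u v w = 0 -> triple v u w = 0.
  by move=> t0; rewrite tripleC t0 oppr0.
move=> V _; case/orP: V => [/triple_vanishing // |].
case/orP=> [/triple_vanishing |]; first by rewrite -triple_rot.
case/orP=> [/triple_vanishing |]; first by rewrite triple_rot.
case/orP=> [/triple_vanishing /swap // |].
case/orP=> [/triple_vanishing|/triple_vanishing].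
  by rewrite triple_rot triple_rot => /swap; rewrite -triple_rot.
by rewrite triple_rot => /swap; rewrite -triple_rot.
Qed.

End Adapted.

(** * Algebras of type C *)

(** The minimal polynomial has every eigenvalue as a root; being irreducible, it
    is then linear. *)
Lemma minpoly_irreducible_scalar (F : fieldType) n (A : 'M[F]_n.+1) l :
  irreducible_poly (mxminpoly A) -> eigenvalue A l -> A = l%:M.
Proof.
case=> _ irr; rewrite eigenvalue_root_min -dvdp_XsubCl => /irr.
rewrite size_XsubC => /(_ isT); rewrite eqp_monic ?monicXsubC ?mxminpoly_monic //.
move=> /eqP pE; have := mx_root_minpoly A.
rewrite -pE rmorphB /= horner_mx_X horner_mx_C => /eqP.
by rewrite subr_eq0 => /eqP.
Qed.

Lemma det_mx2 (F : fieldType) (A : 'M[F]_2) :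
  \det A = A 0 0 * A 1 1 - A 0 1 * A 1 0.
Proof.
rewrite (expand_det_row _ 0) !big_ord_recl big_ord0 /cofactor !det_mx11 !mxE /=.
rewrite addr0 expr0 expr1 mul1r mulN1r mulrN.
by congr (A _ _ * A _ _ - A _ _ * A _ _); apply: val_inj.
Qed.

Section TypeC.
Variables (F : fieldType) (L : saa F) (x y : 'I_5 -> L).
Hypothesis xyA : adapted x y.
Variables (r p11 p12 p21 p22 q11 q12 q21 q22 a1 a2 b4 b5 c d : F).
Hypothesis xyP : presents
  (adapted_presentation r p11 p12 p21 p22 q11 q12 q21 q22 a1 a2 b4 b5 c d) x y.
Hypothesis L3L2 : sprod (lcs L 3) (lcs L 2) = lcs L 5.
Notation X k := (x (idx k)).
Notation Y k := (y (idx k)).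

Let xyB : standard_basis x y. Proof. by case: xyA. Qed.

Let tE := iffLR (adapted_presentsP _ _ _ _ _ _ _ _ _ _ _ _ _ _ _ xyB) xyP.

Lemma lcs3_coordinate v k : v \in lcs L 3 -> (1 < k < 6)%N -> sform (X k) v = 0.
Proof.
case: xyA => _ E5 EZ [_ E4] [_ -> _ _]; rewrite E4 EZ E5.
case/memv_addP=> _ /memv_addP[_ /memv_addP[_ /memv_addP[_
  /memv_addP[_ /vlineP[k5 ->] [_ /vlineP[k4 ->] ->]]
  [_ /vlineP[k3 ->] ->]] [_ /vlineP[k2 ->] ->]]
  [_ /vlineP[k1 ->] ->]] [_ /vlineP[k0 ->] ->].
by move: k => [|[|[|[|[|[|//]]]]]] // _;
  rewrite !sformE !(sform_basisE xyB); compute_eqs; rewrite /=; ring.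
Qed.

(* Discards the coordinates that vanish on an element of L^3. *)
Ltac cubes H :=
  rewrite (lcs3_coordinate (k := 2) H) ?(lcs3_coordinate (k := 3) H)
    ?(lcs3_coordinate (k := 4) H) ?(lcs3_coordinate (k := 5) H) //.

Lemma smul_lcs3 u v : u \in lcs L 3 -> v \in lcs L 3 -> smul u v = 0.
Proof.
move=> u3 v3; apply: sform_nondeg => w; rewrite -/(triple _ _ _) tE.
rewrite adapted_presentationE /det3 /coordinate /=.
by cubes u3; cubes v3; ring.
Qed.

Lemma mul3E v (u : subvs_of (lcs L 3)) : mul3 v u = smul (vsval u) v.
Proof. by rewrite comp_lfunE !lfunE. Qed.

(** As L^3 L^3 = 0 and L^2 = L^3 + F y2, the hypothesis on L^3 L^2 makes
    multiplication by y2 surjective from L^3 to L^5. *)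
Lemma lcs5_image : (lcs L 5 <= limg (mul3 (Y 2)))%VS.
Proof.
rewrite -L3L2; apply/sprod_subP => u v u3.
case: xyA => _ _ _ _ [_ _ -> _] /memv_addP[v' v'3 [_ /vlineP[k ->] ->]].
rewrite smulDr smul_lcs3 // add0r smulZr memvZ //.
have -> : smul u (Y 2) = mul3 (Y 2) (Subvs u3) by rewrite mul3E.
by rewrite memv_img ?memvf.
Qed.

Lemma smul_lcs3_y3 u : u \in lcs L 3 ->
  smul u (Y 3) = triple u (Y 3) (Y 5) *: X 5 + triple u (Y 3) (Y 4) *: X 4.
Proof.
move=> u3; apply/eqP; rewrite -subr_eq0; apply/eqP/sform_nondeg => w.
rewrite !sformE -/(triple _ _ _) !tE !adapted_presentationE.
rewrite /det3 /coordinate /= !(sform_basisE xyB); cubes u3; compute_eqs => /=.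
by ring.
Qed.

(** The pairs (c51, c52) and (c41, c42) are the coordinates on x1, y1 of the
    preimages of x5 and x4 under phi; tau is computed by applying psi to them. *)
Lemma tau_mxE : exists c51 c52 c41 c42 : F,
  [/\ c51 * p11 + c52 * p21 = 0,
      c51 * p12 + c52 * p22 = 1,
      c41 * p11 + c42 * p21 = 1,
      c41 * p12 + c42 * p22 = 0
    & [/\ tau_mx x y 0 0 = c51 * q12 + c52 * q22,
       tau_mx x y 0 1 = c51 * q11 + c52 * q21,
       tau_mx x y 1 0 = c41 * q12 + c42 * q22
     & tau_mx x y 1 1 = c41 * q11 + c42 * q21]].
Proof.
have [u uL3 [uy2 uy3]] : exists2 u : 'I_2 -> L, forall i, u i \in lcs L 3 &
    (forall i, smul (u i) (Y 2) = [tuple X 5; X 4]`_i) /\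
    (forall i, smul (u i) (Y 3) = tau_mx x y i 0 *: X 5 + tau_mx x y i 1 *: X 4).
  set b := [tuple X 5; X 4].
  have bL5 (i : 'I_2) : b`_i \in lcs L 5.
    case: xyA => _ -> _ _ _; case: i => -[|[|//]] i2; rewrite /b /=.
      by rewrite memvE addvSl.
    by rewrite memvE addvSr.
  exists (fun i => vsval ((mul3 (Y 2))^-1%VF b`_i)) => [i|]; first exact: subvsP.
  split=> i; rewrite -mul3E.
    by rewrite limg_lfunVK //; apply/(subvP lcs5_image)/bL5.
  have -> : mul3 (Y 3) ((mul3 (Y 2))^-1%VF b`_i) = tau (Y 2) (Y 3) b`_i.
    by rewrite /tau comp_lfunE.
  rewrite [LHS](@coord_span _ _ _ b).
    rewrite !big_ord_recl big_ord0 addr0 !mxE.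
    by congr (coord _ _ _ *: _ + coord _ _ _ *: _); apply: val_inj.
  rewrite comp_lfunE mul3E smul_lcs3_y3 ?subvsP //.
  by rewrite memvD ?memvZ ?memv_span //= !inE eqxx ?orbT.
pose c1 i := sform (u i) (Y 1); pose c2 i := sform (X 1) (u i).
have tuE i :
  [/\ triple (u i) (Y 2) (Y 4) = c1 i * p11 + c2 i * p21,
       triple (u i) (Y 2) (Y 5) = c1 i * p12 + c2 i * p22,
       triple (u i) (Y 3) (Y 4) = c1 i * q11 + c2 i * q21 &
       triple (u i) (Y 3) (Y 5) = c1 i * q12 + c2 i * q22].
  by split; rewrite [LHS]tE adapted_presentationE /det3 /coordinate /=
      !(sform_basisE xyB); cubes (uL3 i); compute_eqs => /=; rewrite /c1 /c2; ring.
exists (c1 0), (c2 0), (c1 1), (c2 1).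
have [<- <- <- <-] := tuE 0; have [<- <- <- <-] := tuE 1.
rewrite /triple !uy2 !uy3 /= !sformE !(sform_basisE xyB); compute_eqs.
by split; last split; rewrite /= ?mulr0 ?mulr1 ?add0r ?addr0.
Qed.

(** Otherwise x2 would be central. *)
Lemma adapted_r_neq0 : r != 0.
Proof.
apply/eqP => r0; have : X 2 \in centre L.
  apply/memv_ucsS => v; rewrite memv0 smul_eq0 // => {}v w.
  rewrite tE adapted_presentationE /det3 /coordinate /= !(sform_basisE xyB) r0.
  by compute_eqs; rewrite /=; ring.
case: xyA => _ E5 -> _ _; rewrite E5.
case/memv_addP=> _ /memv_addP[_ /vlineP[k5 ->] [_ /vlineP[k4 ->] ->]].
case=> _ /vlineP[k3 ->] /(congr1 (sform^~ (Y 2))).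
rewrite /= !sformE !(sform_basisE xyB); compute_eqs.
rewrite /= !mulr0 !addr0 => /eqP.
by rewrite oner_eq0.
Qed.

Let solution_det c51 c52 c41 c42 :
  c51 * p11 + c52 * p21 = 0 -> c51 * p12 + c52 * p22 = 1 ->
  c41 * p11 + c42 * p21 = 1 ->
  (c41 * c52 - c42 * c51) * (p11 * p22 - p12 * p21) = 1.
Proof.
move=> e1 e2 e3; have -> : (c41 * c52 - c42 * c51) * (p11 * p22 - p12 * p21) =
    (c41 * p11 + c42 * p21) * (c51 * p12 + c52 * p22)
    - (c51 * p11 + c52 * p21) * (c41 * p12 + c42 * p22) by ring.
by rewrite e1 e2 e3 mulr1 mul0r subr0.
Qed.

Lemma adapted_phi_inj : p11 * p22 - p12 * p21 != 0.
Proof.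
have [c51 [c52 [c41 [c42 [e1 e2 e3 _ _]]]]] := tau_mxE.
apply: contra_eq_neq (solution_det e1 e2 e3) => ->.
by rewrite mulr0 eq_sym oner_neq0.
Qed.

(** A root l of the determinant is an eigenvalue of tau, so tau = l by
    irreducibility, that is psi = l phi.  But then all products of y3 - l y2
    lie in the span of x2, ..., x5, which is Z_2(L), and y3 - l y2 would lie in
    Z_3(L) = L^3. *)
Lemma adapted_pencil l : irreducible_poly (mxminpoly (tau_mx x y)) ->
  (q11 - l * p11) * (q22 - l * p22) - (q12 - l * p12) * (q21 - l * p21) != 0.
Proof.
have [c51 [c52 [c41 [c42 [e1 e2 e3 e4]]]]] := tau_mxE.
move: (tau_mx x y) => t [t00 t01 t10 t11] irr; apply/eqP => D0.
have tE' : t = l%:M.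
  apply: minpoly_irreducible_scalar irr _.
  have /det0P[v v0 vt] : \det (t - l%:M) == 0.
    rewrite det_mx2 !mxE t00 t01 t10 t11 /= mulr1n mulr0n; apply/eqP.
    transitivity ((c51 * q12 + c52 * q22 - l * (c51 * p12 + c52 * p22)) *
        (c41 * q11 + c42 * q21 - l * (c41 * p11 + c42 * p21)) -
        (c51 * q11 + c52 * q21 - l * (c51 * p11 + c52 * p21)) *
        (c41 * q12 + c42 * q22 - l * (c41 * p12 + c42 * p22))).
      by rewrite e1 e2 e3 e4; ring.
    by rewrite -[RHS](mulr0 (c41 * c52 - c42 * c51)) -[0 in RHS]D0; ring.
  apply/eigenvalueP; exists v => //; apply/eqP.
  by rewrite -subr_eq0 -mul_mx_scalar -mulmxBr vt.
have C0 : c41 * c52 - c42 * c51 != 0.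
  apply: contra_eq_neq (solution_det e1 e2 e3) => ->.
  by rewrite mul0r eq_sym oner_neq0.
rewrite {}tE' !mxE /= mulr1n mulr0n in t00 t01 t10 t11.
have solve u v :
    c41 * u + c42 * v = 0 -> c51 * u + c52 * v = 0 -> u = 0 /\ v = 0.
  move=> uv4 uv5; split; apply: (mulfI C0); rewrite mulr0.
    transitivity (c52 * (c41 * u + c42 * v) - c42 * (c51 * u + c52 * v)).
      by ring.
    by rewrite uv4 uv5 !mulr0 subr0.
  transitivity (c41 * (c51 * u + c52 * v) - c51 * (c41 * u + c42 * v)).
    by ring.
  by rewrite uv4 uv5 !mulr0 subr0.
have [/subr0_eq Q11 /subr0_eq Q21] : q11 - l * p11 = 0 /\ q21 - l * p21 = 0.
  apply: solve.
    transitivity (c41 * q11 + c42 * q21 - l * (c41 * p11 + c42 * p21)).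
      by ring.
    by rewrite -t11 e3 mulr1 subrr.
  transitivity (c51 * q11 + c52 * q21 - l * (c51 * p11 + c52 * p21)).
    by ring.
  by rewrite -t01 e1 mulr0 subrr.
have [/subr0_eq Q12 /subr0_eq Q22] : q12 - l * p12 = 0 /\ q22 - l * p22 = 0.
  apply: solve.
    transitivity (c41 * q12 + c42 * q22 - l * (c41 * p12 + c42 * p22)).
      by ring.
    by rewrite -t10 e4 mulr0 subrr.
  transitivity (c51 * q12 + c52 * q22 - l * (c51 * p12 + c52 * p22)).
    by ring.
  by rewrite -t00 e2 mulr1 subrr.
have : Y 3 - l *: Y 2 \in lcs L 3.
  case: xyA => _ E5 EZ [E24 E4] [<- _ _ _].
  apply/memv_ucsS => w; rewrite E24 E4 EZ E5.
  have zwE (z := Y 3 - l *: Y 2) : smul z w =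
      triple z w (Y 5) *: X 5 + triple z w (Y 4) *: X 4
      + triple z w (Y 3) *: X 3 + triple z w (Y 2) *: X 2.
    rewrite {}/z.
    apply/eqP; rewrite -subr_eq0; apply/eqP/sform_nondeg => w'.
    rewrite sformDl sformNl !(sformDl _ _ w') !(sformZl _ _ w').
    rewrite -/(triple _ w w') !tE.
    rewrite !adapted_presentationE /det3 /coordinate /= !sformE !(sform_basisE xyB).
    by compute_eqs => /=; rewrite Q11 Q12 Q21 Q22; ring.
  by rewrite zwE !memv_add // memvZ // memv_line.
move/lcs3_coordinate/(_ (isT : 1 < 3 < 6)%N).
rewrite !sformE !(sform_basisE xyB); compute_eqs; rewrite /= mulr0 subr0 => /eqP.
by rewrite oner_eq0.
Qed.

End TypeC.

(** * The normal form *)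

Section NormalForm.
Variables (F : fieldType) (L : saa F).
Implicit Types (x y : 'I_5 -> L).

(** Replacing x4 and x5 by the products of x1 and y1 by y2 makes phi the identity
    matrix and turns psi into q p^-1. *)
Lemma normalize_phi x y r p11 p12 p21 p22 q11 q12 q21 q22 a1 a2 b4 b5 c d
    (D := p11 * p22 - p12 * p21) : standard_basis x y ->
  presents
    (adapted_presentation r p11 p12 p21 p22 q11 q12 q21 q22 a1 a2 b4 b5 c d)
    x y ->
  D != 0 ->
  has_presentation L (adapted_presentation (r / D) 1 0 0 1
    ((q11 * p22 - q12 * p21) / D) ((q12 * p11 - q11 * p12) / D)
    ((q21 * p22 - q22 * p21) / D) ((q22 * p11 - q21 * p12) / D)
    (a1 / D) (a2 / D) ((b4 * p22 - b5 * p21) / D) ((b5 * p11 - b4 * p12) / D)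
    (c / D) (d / D)).
Proof.
move=> xyB /(adapted_presentsP _ _ _ _ _ _ _ _ _ _ _ _ _ _ _ xyB) tE D0.
pose x' := fam5 (x (idx 1)) (x (idx 2)) (x (idx 3))
  (p11 *: x (idx 4) + p12 *: x (idx 5)) (p21 *: x (idx 4) + p22 *: x (idx 5)).
pose y' := fam5 (y (idx 1)) (y (idx 2)) (y (idx 3))
  ((p22 / D) *: y (idx 4) - (p21 / D) *: y (idx 5))
  ((p11 / D) *: y (idx 5) - (p12 / D) *: y (idx 4)).
have x'y'B : standard_basis x' y'.
  rewrite /x' /y'; apply: standard_basisP; first exact: standard_basis_dim xyB.
  - by gram xyB; ring.
  - by gram xyB; ring.
  - by gram xyB; rewrite /D in D0 *; field.
exists x', y'; split=> //.
apply/(adapted_presentsP _ _ _ _ _ _ _ _ _ _ _ _ _ _ _ x'y'B) => u v w.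
rewrite tE !adapted_presentationE /det3 /coordinate /= /x' /y' !fam5E !sformE.
rewrite ?(sformC _ (x _)) ?(sformC (y _)) /D in D0 *.
by field.
Qed.

(** Adding multiples of x2 to x1 and y1 removes a1 and a2, as r is nonzero; adding elements of L^3 to y3 removes b4 and b5, as phi is
    bijective; adding multiples of x2 to y2 and y3 removes c and d.  The form is
    restored by multiples of x3, which is central, and by adding multiples of x1
    and y1 to y2, which replaces b4 and b5 by g1 and g2. *)
Lemma kill_tail x y r m11 m12 m21 m22 a1 a2 b4 b5 c d : standard_basis x y ->
  presents
    (adapted_presentation r 1 0 0 1 m11 m12 m21 m22 a1 a2 b4 b5 c d) x y ->
  r != 0 ->
  has_presentation L
    (adapted_presentation r 1 0 0 1 m11 m12 m21 m22 0 0 0 0 0 0).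
Proof.
move=> xyB /(adapted_presentsP _ _ _ _ _ _ _ _ _ _ _ _ _ _ _ xyB) tE r0.
pose f1 := - a1 / r; pose f2 := - a2 / r.
pose g1 := b4 + f2 * m11 - f1 * m21; pose g2 := b5 + f2 * m12 - f1 * m22.
pose h := - (d + g1 * a1 + g2 * a2) / r.
pose x' := fam5 (x (idx 1) + f1 *: x (idx 2) - g2 *: x (idx 3))
  (x (idx 2)) (x (idx 3)) (x (idx 4)) (x (idx 5)).
pose y' := fam5 (y (idx 1) + f2 *: x (idx 2) + g1 *: x (idx 3))
  (y (idx 2) + f2 *: x (idx 1) - f1 *: y (idx 1) - (c / r) *: x (idx 2)
   + (h - f2 * g2 - f1 * g1) *: x (idx 3))
  (y (idx 3) + g1 *: x (idx 1) + g2 *: y (idx 1) + h *: x (idx 2))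
  (y (idx 4)) (y (idx 5)).
have x'y'B : standard_basis x' y'.
  rewrite /x' /y'; apply: standard_basisP; first exact: standard_basis_dim xyB.
  - by gram xyB; ring.
  - by gram xyB; ring.
  - by gram xyB; ring.
exists x', y'; split=> //.
apply/(adapted_presentsP _ _ _ _ _ _ _ _ _ _ _ _ _ _ _ x'y'B) => u v w.
rewrite tE !adapted_presentationE /det3 /coordinate /= /x' /y' !fam5E !sformE.
rewrite ?(sformC _ (x _)) ?(sformC (y _)) /h /g1 /g2 /f1 /f2.
by field.
Qed.

(** With t half the trace of tau, replacing y3 by y3 - t y2 makes tau traceless,
    so that its square is scalar.  Replacing x1 by x1 + k y1 then makes y1 y3
    proportional to x1 y2, and scaling y2 makes these products equal. *)
Lemma normalize_psi x y r m11 m12 m21 m22 (n := (m11 - m22) / 2%:R) :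
  standard_basis x y ->
  presents (adapted_presentation r 1 0 0 1 m11 m12 m21 m22 0 0 0 0 0 0) x y ->
  2%:R != 0 :> F -> m21 != 0 ->
  has_presentation L
    (P_10_3_8 (r / m21 ^+ 3) ((m12 * m21 + n ^+ 2) / m21 ^+ 2)).
Proof.
move=> xyB /(adapted_presentsP _ _ _ _ _ _ _ _ _ _ _ _ _ _ _ xyB) tE two0 m0.
pose t := (m11 + m22) / 2%:R; pose k := - n / m21.
pose x' := fam5 (x (idx 1) + k *: y (idx 1))
  (m21^-1 *: (x (idx 2) + t *: x (idx 3)))
  (x (idx 3)) (m21 *: (x (idx 4) + k *: x (idx 5))) (m21 *: x (idx 5)).
pose y' := fam5 (y (idx 1)) (m21 *: y (idx 2)) (y (idx 3) - t *: y (idx 2))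
  (m21^-1 *: y (idx 4)) (m21^-1 *: (y (idx 5) - k *: y (idx 4))).
have x'y'B : standard_basis x' y'.
  rewrite /x' /y'; apply: standard_basisP; first exact: standard_basis_dim xyB.
  - by gram xyB; ring.
  - by gram xyB; ring.
  - by gram xyB; field.
exists x', y'; split=> //.
apply/(P_10_3_8_presentsP _ _ x'y'B) => u v w.
rewrite tE P_10_3_8E adapted_presentationE /det3 /coordinate /= /x' /y'.
rewrite !fam5E !sformE.
rewrite ?(sformC _ (x _)) ?(sformC (y _)) /k /t /n.
by field; rewrite m0 two0.
Qed.

(** The last hypothesis says that tau has no eigenvalue in F.  For l = m11 it
    gives m21 <> 0, and for l = (m11 + m22) / 2 + b m21 it shows that s is not
    the square of b. *)
Lemma normal_form x y r p11 p12 p21 p22 q11 q12 q21 q22 a1 a2 b4 b5 c d :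
  standard_basis x y ->
  presents
    (adapted_presentation r p11 p12 p21 p22 q11 q12 q21 q22 a1 a2 b4 b5 c d)
    x y ->
  2%:R != 0 :> F -> r != 0 -> p11 * p22 - p12 * p21 != 0 ->
  (forall l, (q11 - l * p11) * (q22 - l * p22)
             - (q12 - l * p12) * (q21 - l * p21) != 0) ->
  exists r s : F,
    [/\ r != 0, ~ is_square s & has_presentation L (P_10_3_8 r s)].
Proof.
move=> xyB xyP two0 r0 D0 pencil.
have [x1 [y1 [xyB1 xyP1]]] := normalize_phi xyB xyP D0.
have [x2 [y2 [xyB2 {xyP1}]]] :=
  kill_tail xyB1 xyP1 (mulf_neq0 r0 (invr_neq0 D0)).
set D := p11 * p22 - p12 * p21 in D0 *.
set m11 := (q11 * _ - _) / _; set m12 := (q12 * _ - _) / _.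
set m21 := (q21 * _ - _) / _; set m22 := (q22 * _ - _) / _ => xyP2.
have {}pencil l : (m11 - l) * (m22 - l) - m12 * m21 != 0.
  suff -> : (m11 - l) * (m22 - l) - m12 * m21 =
      ((q11 - l * p11) * (q22 - l * p22)
       - (q12 - l * p12) * (q21 - l * p21)) / D.
    by rewrite mulf_neq0 ?invr_eq0.
  by rewrite /m11 /m12 /m21 /m22 /D in D0 *; field.
have m21_neq0 : m21 != 0.
  by apply: contra_neq (pencil m11) => ->; rewrite subrr mul0r mulr0 subr0.
have := normalize_psi xyB2 xyP2 two0 m21_neq0.
set s := (_ + _) / _ => LP; exists (r / D / m21 ^+ 3), s; split=> //.
  by rewrite !mulf_neq0 ?invr_eq0 ?expf_neq0.
move=> [b sE]; have := pencil ((m11 + m22) / 2%:R + b * m21).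
apply/negP; rewrite negbK.
have {}sE : b ^+ 2 * m21 ^+ 2 = m12 * m21 + ((m11 - m22) / 2%:R) ^+ 2.
  by rewrite -sE divfK ?expf_neq0.
apply/eqP; transitivity
  (b ^+ 2 * m21 ^+ 2 - (m12 * m21 + ((m11 - m22) / 2%:R) ^+ 2)).
  by field.
by rewrite sE subrr.
Qed.

End NormalForm.

(** * Classification *)

Lemma type_C_presentation (F : fieldType) (L : saa F) :
  2%N \notin [pchar F] -> sprod (lcs L 3) (lcs L 2) = lcs L 5 -> type_C L ->
  exists r s : F,
    [/\ r != 0, ~ is_square s & has_presentation L (P_10_3_8 r s)].
Proof.
move=> char2 L3L2 [x [y [xyA irr]]].
have two0 : 2%:R != 0 :> F by move: char2; rewrite inE.
have xyB : standard_basis x y by case: xyA.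
have xyP := presents_adapted xyA L3L2.
apply: (normal_form xyB xyP two0).
- exact: (adapted_r_neq0 xyA xyP).
- exact: (adapted_phi_inj xyA xyP L3L2).
- by move=> l; apply: (adapted_pencil xyA xyP L3L2 _ irr).
Qed.

Theorem proposition4p13 (F : fieldType) (charF : 2%N \notin [pchar F]) :
  (forall L : saa F,
     nilpotent L -> \dim {:L} = 10%N ->
     isotropic (centre L) -> \dim (centre L) = 3%N ->
     \dim (lcs L 3) = 6%N -> sprod (lcs L 3) (lcs L 2) = lcs L 5 ->
     type_C L ->
     exists r s : F,
       [/\ r != 0, ~ is_square s & has_presentation L (P_10_3_8 r s)])
  /\
  (forall r r' s s' : F,
     r != 0 -> r' != 0 -> ~ is_square s -> ~ is_square s' ->
     forall L L' : saa F,
       has_presentation L (P_10_3_8 r s) ->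
       has_presentation L' (P_10_3_8 r' s') ->
       (saa_iso L' L <-> is_nonzero_cube (r' / r) /\ in_G s (s / s'))).
Proof.
split=> [L _ _ _ _ _|r r' s s' r0 r'0 s_ns s'_ns L L' [x [y [xyB xyP]]] L'P].
  exact: type_C_presentation.
have nonzero (t : F) : ~ is_square t -> t != 0.
  by move=> t_ns; apply/eqP => t0; apply: t_ns; exists 0; rewrite t0 expr0n.
have [s0 s'0] := (nonzero s s_ns, nonzero s' s'_ns).
split=> [/has_presentation_iso/(_ L'P)[x' [y' [xyB' xyP']]]|].
  have [a [b [c [c0 r'E sE]]]] :=
    presentation_parameters charF r0 r'0 xyB xyP xyB' xyP'.
  split.
    by exists c^-1; rewrite invr_eq0 c0 r'E exprVn mulrAC mulfV ?mul1r.
  exists a, b; split; last by rewrite [X in X / _]sE mulrAC mulfV ?mul1r.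
  apply/eqP => -[a0 b0]; move: s0; rewrite sE a0 b0 expr0n mul0r subr0.
  by rewrite expr0n mulr0 eqxx.
move=> [[e [e0 r'E]] [a [b [_ sE]]]].
have n0 : a ^+ 2 - b ^+ 2 * s != 0.
  apply/eqP => n0; have : s / s' == 0 by rewrite sE n0 expr0n.
  by rewrite mulf_eq0 invr_eq0 (negPf s0) (negPf s'0).
apply: (saa_iso_presentation (P_10_3_8_consistent r' s') L'P).
have := P_10_3_8_rescale xyB xyP (_ : e^-1 != 0) n0; rewrite invr_eq0 => /(_ e0).
by rewrite -sE exprVn invrK -r'E invf_div [r * _]mulrC [s * _]mulrC !divfK.
Qed.
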